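(* Let $S$ be a bilateral weighted shift on a complex Hilbert space $\mathcal{H}$ with orthonormal basis $(e_n)_{n\in\mathbb{Z}}$ and bounded weight sequence $(\omega_n)_{n\in\mathbb{Z}}$ of positive real numbers, i.e. $Se_n=\omega_n e_{n+1}$ for all $n\in\mathbb{Z}$. Assume that $r_2^-(S)\le r_3^+(S)$. For every non-zero $x\in\mathcal{H}$: (a) If $R_\omega^-(x)<r_2^-(S)$ and $r_3^+(S)<R_\omega^+(x)$, then $\sigma_S(x)=\{\lambda\in\mathbb{C}:r_2^-(S)\le|\lambda|\le r_3^+(S)\}$. (b) Otherwise (i.e. if the hypothesis of (a) fails), $\{\lambda\in\mathbb{C}:\max(R_\omega^-(x),r_2^-(S))<|\lambda|<\min(R_\omega^+(x),r_3^+(S))\}\subset\sigma_S(x)$.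
   Context: Put $\beta_n=\omega_0\cdots\omega_{n-1}$ for $n>0$, $\beta_0=1$, and $\beta_n=\frac{1}{\omega_n\cdots\omega_{-1}}$ for $n<0$. Define $r_2^-(S)=\liminf_{n\to+\infty}[1/\beta_{-n}]^{1/n}$ and $r_3^+(S)=\limsup_{n\to+\infty}\beta_n^{1/n}$. For non-zero $x=\sum_{n\in\mathbb{Z}}a_ne_n\in\mathcal{H}$ define $R_\omega^-(x)=\limsup_{n\to+\infty}|a_{-n}/\beta_{-n}|^{1/n}$ and $R_\omega^+(x)=\liminf_{n\to+\infty}|\beta_n/a_n|^{1/n}\in[0,+\infty]$, with the convention that $|\beta_n/a_n|^{1/n}=+\infty$ when $a_n=0$. For a bounded linear operator $T$ on $\mathcal{H}$ and $x\in\mathcal{H}$, the local resolvent set $\rho_T(x)$ is the union of all open $U\subset\mathbb{C}$ for which there is an analytic $f:U\to\mathcal{H}$ with $(T-\lambda)f(\lambda)=x$ for all $\lambda\in U$; the local spectrum is $\sigma_T(x)=\mathbb{C}\setminus\rho_T(x)$. *)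

(* Defs.v *)
From HB Require Import structures.
From mathcomp Require Import all_boot all_order all_algebra.
From mathcomp Require Import all_classical all_reals all_analysis.
From mathcomp Require Import complex sesquilinear.

Set Implicit Arguments.
Unset Strict Implicit.
Unset Printing Implicit Defensive.

Import Order.TTheory GRing.Theory Num.Theory.
Import numFieldNormedType.Exports.

Local Open Scope classical_set_scope.
Local Open Scope ring_scope.

(* The norm `|z| of z : R[i] lives in R[i]; this is the same modulus as an
   element of R. *)
Notation modulus := ComplexField.Normc.normc.

(* Inner products {dot H for Num.conj} are linear in the first argument and
   conjugate-linear in the second one, so the n-th coordinate of x in an
   orthonormal basis e is dot x (e n). *)
Section HilbertBasis.
Variables (R : realType) (H : completeNormedModType R[i]).
Variable dot : {dot H for (@Num.conj R[i])}.

Definition linear_span (e : int -> H) : set H :=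
  [set y | exists (s : seq int) (c : int -> R[i]), y = \sum_(n <- s) c n *: e n].

Definition orthonormal_basis (e : int -> H) : Prop :=
  (forall m n : int, dot (e m) (e n) = (m == n)%:R) /\ dense (linear_span e).

End HilbertBasis.

(* The complex plane as a topological space is R[i]^o: the library puts the
   topology of the norm on this alias of R[i]. *)
Section LocalSpectrum.
Variables (R : realType) (H : completeNormedModType R[i]).

Definition analytic_on (U : set R[i]^o) (f : R[i]^o -> H) : Prop :=
  forall z, U z -> derivable f z 1.

Definition local_resolvent (T : H -> H) (x : H) : set R[i]^o :=
  \bigcup_(U in [set U : set R[i]^o | open U /\
      exists2 f : R[i]^o -> H, analytic_on U f &
        forall z : R[i]^o, U z -> T (f z) - (z : R[i]) *: f z = x]) U.

Definition local_spectrum (T : H -> H) (x : H) : set R[i]^o :=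
  ~` local_resolvent T x.

End LocalSpectrum.

Section Weights.
Variable R : realType.
Implicit Types (w : int -> R) (a : int -> R[i]).

(* Negz k is the integer - k.+1 *)
Definition beta w (n : int) : R :=
  match n with
  | Posz k => \prod_(0 <= i < k) w i%:Z
  | Negz k => (\prod_(1 <= i < k.+2) w (- i%:Z))^-1
  end.

(* The limits below do not depend on the value of nth_root at n = 0. *)
Definition nth_root (n : nat) (y : R) : R := y `^ n%:R^-1.

Definition r2_minus w : \bar R :=
  limn_einf (fun n : nat => (nth_root n (1 / beta w (- n%:Z)))%:E).

Definition r3_plus w : \bar R :=
  limn_esup (fun n : nat => (nth_root n (beta w n%:Z))%:E).

Definition R_minus w a : \bar R :=
  limn_esup (fun n : nat =>
    (nth_root n (modulus (a (- n%:Z) / (beta w (- n%:Z))%:C%C)))%:E).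

Definition R_plus w a : \bar R :=
  limn_einf (fun n : nat =>
    if a n%:Z == 0 then +oo%E
    else (nth_root n (modulus ((beta w n%:Z)%:C%C / a n%:Z)))%:E).

End Weights.

(* Main.v *)
Require Import Defs.
From HB Require Import structures.
From mathcomp Require Import all_boot all_order all_algebra.
From mathcomp Require Import all_classical all_reals all_analysis.
From mathcomp Require Import complex sesquilinear.
From mathcomp Require Import ring lra zify.

Set Implicit Arguments.
Unset Strict Implicit.
Unset Printing Implicit Defensive.

Import Order.TTheory GRing.Theory Num.Theory.
Import numFieldNormedType.Exports.

Local Open Scope classical_set_scope.
Local Open Scope ring_scope.

(** Divide the coordinates of a vector by the products of weights: put
    [hat y n] for the coordinate of y along [e n] divided by [beta w n].  As
    beta_(n+1) = w_n beta_n, the shift becomes multiplication by X on formal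
    Laurent series, and the equation (S - mu) y = x says that the series of y is
    the quotient of the series of x by X - mu.

    The closed annulus lies in the local spectrum
    ([annulus_sub_local_spectrum]).  Let lam satisfy r2 <= |lam| <= r3, let the
    series of x converge on a neighbourhood of the circle |z| = |lam|, and let f
    solve the resolvent equation near lam.  When |nu| < r3, some coefficients of
    f(nu) of arbitrarily large index are small, because beta_n is large there;
    telescoping the recurrence from these indices bounds every coefficient of
    nonnegative index by a tail of the series of x ([resolvent_coef_pos]).  When
    |nu| > r2 the same holds for nonpositive indices ([resolvent_coef_neg]).
    The two regions need not meet, but f is continuous: a point mu with
    |mu| = |lam| is a radial limit from both sides, so both bounds hold for f(mu).
    Hence the series of x has a geometrically decaying quotient by X - mu, which
    means that it vanishes at mu.  It vanishes on an arc of the circle, so x = 0.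
    The bounds on |lam| are not strict, which covers the case r2 = r3 of part
    (a); part (b) is the strict case.

    The identity theorem used here ([laurent_identity]) is proved by division.
    After rescaling, the circle is the unit circle and the coefficients are at
    most C theta^|k|.  Dividing by X - z at a zero z keeps the rate theta and
    multiplies the constant by at most a number K that does not depend on z.
    Dividing by n zeros z_i and then evaluating at z' shows that the value at z'
    is at most a constant times the product of the K |z' - z_i|.  With
    arbitrarily many zeros accumulating at a point, the series vanishes at
    distance less than 1/K from it, and so, step by step, at all powers of a root
    of unity close to 1.  Averaging over these powers isolates each coefficient.

    Outside the annulus, under the hypothesis of part (a), there is a weight om
    such that |hat x| <= C om, om beta is summable, and division by X - mu is a
    bounded operator T_mu on the sequences dominated by om, uniformly for mu near
    lam: sum from the left when |mu| > r3, from the right when |mu| < r2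
    ([uniquely_divides_back], [uniquely_divides_fwd]).  The vector f(mu) with
    coordinates T_mu (hat x) solves the resolvent equation, and
    f(mu + h) - f(mu) = h T_mu f(mu) + h^2 T_(mu+h) T_mu f(mu)
    shows that f is derivable ([local_resolvent_of_solver]). *)

(** * The modulus and geometric series *)

Section Modulus.
Variable R : realType.
Implicit Types (z : R[i]).

Lemma normr_modulus z : `|z| = (modulus z)%:C%C. Proof. by []. Qed.

Lemma modulus_ge0 z : 0 <= modulus z.
Proof. by case: z => a b; exact: sqrtr_ge0. Qed.

Lemma modulusM : {morph @ComplexField.Normc.normc R : x y / x * y}.
Proof. exact: ComplexField.Normc.normcM. Qed.

Lemma modulus1 : modulus (1 : R[i]) = 1.
Proof. exact: ComplexField.Normc.normc1. Qed.

Lemma modulus0 : modulus (0 : R[i]) = 0.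
Proof. exact: ComplexField.Normc.normc0. Qed.

Lemma modulusV z : modulus z^-1 = (modulus z)^-1.
Proof. exact: ComplexField.Normc.normcV. Qed.

Lemma modulusX z n : modulus (z ^+ n) = modulus z ^+ n.
Proof. by elim: n => [|n IH]; rewrite ?expr0 ?modulus1 // !exprS modulusM IH. Qed.

Lemma modulusXz z (k : int) : modulus (z ^ k) = modulus z ^ k.
Proof.
case: k => k; first by rewrite -!exprnP modulusX.
by rewrite NegzE -!exprnN modulusV modulusX.
Qed.

Lemma modulus_eq0 z : modulus z = 0 -> z = 0.
Proof. exact: ComplexField.Normc.eq0_normc. Qed.

Lemma modulusN z : modulus (- z) = modulus z.
Proof. by apply: complexI; rewrite -!normr_modulus normrN. Qed.

Lemma modulusD z1 z2 : modulus (z1 + z2) <= modulus z1 + modulus z2.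
Proof.
by rewrite -lecR rmorphD -!normr_modulus ler_normD.
Qed.

Lemma modulusB z1 z2 : modulus (z1 - z2) <= modulus z1 + modulus z2.
Proof. by rewrite -(modulusN z2) modulusD. Qed.

Lemma modulus_dist z1 z2 : modulus (z1 - z2) = modulus (z2 - z1).
Proof. by rewrite -modulusN opprB. Qed.

Lemma modulus_sum (I : Type) (s : seq I) (P : pred I) (F : I -> R[i]) :
  modulus (\sum_(i <- s | P i) F i) <= \sum_(i <- s | P i) modulus (F i).
Proof.
elim/big_rec2: _ => [|i y1 y2 _ h]; first by rewrite modulus0.
by apply: le_trans (modulusD _ _) _; rewrite lerD2l.
Qed.

Lemma modulusR (r : R) : modulus (r%:C)%C = `|r|.
Proof. by rewrite /= expr0n addr0 sqrtr_sqr. Qed.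

Lemma modulus_gt0 z : (0 < modulus z) = (z != 0).
Proof.
rewrite lt_def modulus_ge0 andbT; congr negb; apply/eqP/eqP => [/modulus_eq0|->] //.
exact: modulus0.
Qed.

Lemma modulus_Re z : `|complex.Re z| <= modulus z.
Proof. by rewrite -lecR -normr_modulus normc_ge_Re. Qed.

Lemma modulus_Im z : `|complex.Im z| <= modulus z.
Proof.
case: z => a b /=; rewrite -sqrtr_sqr ler_sqrt ?addr_ge0 ?sqr_ge0 //.
by rewrite lerDr sqr_ge0.
Qed.

(** Reduces the convergence of complex series to that of real ones. *)
Lemma modulus_ReIm z : modulus z <= `|complex.Re z| + `|complex.Im z|.
Proof.
case: z => a b; rewrite (_ : (a +i* b)%C = a%:C%C + 'i%C * b%:C%C); last first.
  by rewrite [LHS]complexE.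
apply: le_trans (modulusD _ _) _; rewrite modulusM !modulusR /=.
by rewrite expr0n expr1n add0r sqrtr1 mul1r !mul0r !mul1r !subr0 !add0r !addr0.
Qed.

End Modulus.

Section GeometricDecay.
Variable R : realType.
Implicit Types (rho C : R).

Lemma expr_lt_eps rho C e : 0 <= rho < 1 -> 0 < e ->
  exists N, forall n, (N <= n)%N -> C * rho ^+ n < e.
Proof.
move=> /andP[rho0 rho1] e0.
have : (fun n => C * rho ^+ n) @ \oo --> (0 : R).
  by apply: cvg_geometric; rewrite ger0_norm.
move/cvgrPdist_lt => /(_ e e0)[N _ hN]; exists N => n /hN /=.
by rewrite sub0r normrN => /ltr_normlW.
Qed.

Lemma le0_of_geometric rho C (x : R) : 0 <= rho < 1 ->
  (forall n, x <= C * rho ^+ n) -> x <= 0.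
Proof.
move=> hrho h; rewrite leNgt; apply/negP => x0.
have [N hN] := expr_lt_eps C hrho x0.
by have := lt_le_trans (hN N (leqnn N)) (h N); rewrite ltxx.
Qed.

End GeometricDecay.

Section GeometricSeries.

Lemma geometric_series_tail (K : numFieldType) (V : normedModType K)
    (v : nat -> V) (C rho : K) (m n : nat) :
  0 <= rho -> rho < 1 -> (forall i, `|v i| <= C * rho ^+ i) ->
  `|\sum_(i < n) v (m + i)%N| <= C / (1 - rho) * rho ^+ m.
Proof.
move=> rho0 rho1 hv.
have C0 : 0 <= C by have := hv 0%N; rewrite expr0 mulr1; exact: le_trans.
have h1 : 0 < 1 - rho by rewrite subr_gt0.
suff : `|\sum_(i < n) v (m + i)%N| <= C / (1 - rho) * rho ^+ m * (1 - rho ^+ n).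
  move=> h; apply: le_trans h _; rewrite ler_piMr //.
    by rewrite mulr_ge0 ?exprn_ge0 // divr_ge0 // ltW.
  by rewrite lerBlDr lerDl exprn_ge0.
elim: n => [|n IH]; first by rewrite big_ord0 normr0 expr0 subrr mulr0.
rewrite big_ord_recr /=; apply: le_trans (ler_normD _ _) _.
apply: le_trans (lerD IH (hv _)) _.
rewrite le_eqVlt; apply/orP; left; apply/eqP.
rewrite exprD exprS; field.
by rewrite subr_eq0 eq_sym lt_eqF.
Qed.

(** The geometric sequence is asked to be small inside K itself, since the norm of
    a complex space takes its values in the complex numbers. *)
Lemma geometric_series (K : numFieldType) (V : completeNormedModType K)
    (v : nat -> V) (C rho : K) :
  0 <= rho -> rho < 1 ->
  (forall A e : K, 0 <= A -> 0 < e ->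
     exists N, forall n, (N <= n)%N -> A * rho ^+ n < e) ->
  (forall i, `|v i| <= C * rho ^+ i) ->
  exists s, forall n, `|s - \sum_(i < n) v i| <= C / (1 - rho) * rho ^+ n.
Proof.
move=> rho0 rho1 small hv.
have C0 : 0 <= C by have := hv 0%N; rewrite expr0 mulr1; exact: le_trans.
have h1 : 0 < 1 - rho by rewrite subr_gt0.
have tail N n : (N <= n)%N ->
    `|\sum_(i < n) v i - \sum_(i < N) v i| <= C / (1 - rho) * rho ^+ N.
  move=> Nn; have := geometric_series_tail N (n - N) rho0 rho1 hv.
  have -> : \sum_(i < n) v i = \sum_(i < N + (n - N)) v i by rewrite subnKC.
  by rewrite big_split_ord /= addrAC subrr add0r.
pose u (n : nat) := \sum_(i < n) v i.
have : cvg (u @ \oo).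
  apply/cauchy_cvgP/cauchy_exP => e e0.
  have B0 : 0 <= C / (1 - rho) by rewrite divr_ge0 // ltW.
  have [N hN] := small _ e B0 e0.
  exists (u N); exists N => //= n /= Nn.
  rewrite -ball_normE /= distrC.
  exact: le_lt_trans (tail _ _ Nn) (hN N (leqnn N)).
move=> /cvg_ex [s hs]; exists s => n.
apply/ler_addgt0Pr => e e0.
move/cvgrPdist_lt : hs => /(_ e e0)[N _ hN].
have {hN}/= hN := hN (maxn N n) (leq_maxl N n).
rewrite -(subrK (u (maxn N n)) s) -addrA addrC.
apply: le_trans (ler_normD _ _) _.
by rewrite lerD ?tail ?leq_maxr // ltW.
Qed.

End GeometricSeries.

Section ComplexSeries.
Variable R : realType.
Implicit Types (a : nat -> R[i]).

Lemma complex_geometric_series a (C rho : R) : 0 <= rho < 1 ->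
  (forall i, modulus (a i) <= C * rho ^+ i) ->
  exists s, forall n,
    modulus (s - \sum_(i < n) a i) <= 2 * C / (1 - rho) * rho ^+ n.
Proof.
move=> hrho ha; have /andP[rho0 rho1] := hrho.
have small (A e : R) : 0 <= A -> 0 < e ->
      exists N, forall n, (N <= n)%N -> A * rho ^+ n < e.
  by move=> _ e0; exact: expr_lt_eps.
have [|s1 h1] :=
    @geometric_series R R^o (fun i => complex.Re (a i)) C rho rho0 rho1 small.
  by move=> i; apply: le_trans (modulus_Re _) (ha i).
have [|s2 h2] :=
    @geometric_series R R^o (fun i => complex.Im (a i)) C rho rho0 rho1 small.
  by move=> i; apply: le_trans (modulus_Im _) (ha i).
exists (s1 +i* s2)%C => n.
apply: le_trans (modulus_ReIm _) _.
have -> : 2 * C / (1 - rho) * rho ^+ n =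
  C / (1 - rho) * rho ^+ n + C / (1 - rho) * rho ^+ n by ring.
apply: lerD.
- have := h1 n; congr (_ <= _); congr `| _ |.
  have -> : \sum_(i < n) complex.Re (a i) = complex.Re (\sum_(i < n) a i).
    by rewrite (raddf_sum (@complex.Re R)).
  by case: (\sum_(i < n) a i).
- have := h2 n; congr (_ <= _); congr `| _ |.
  have -> : \sum_(i < n) complex.Im (a i) = complex.Im (\sum_(i < n) a i).
    by rewrite (raddf_sum (@complex.Im R)).
  by case: (\sum_(i < n) a i).
Qed.

(** The rate is measured from one term later than in [geometric_series], so that
    prepending a term to a series does not change the constants. *)
Definition is_sum a (s : R[i]) : Prop :=
  exists C rho : R, 0 <= rho < 1 /\
    forall n, modulus (s - \sum_(i < n.+1) a i) <= C * rho ^+ n.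

Lemma is_sum_uniq a s t : is_sum a s -> is_sum a t -> s = t.
Proof.
move=> [C [rho [hrho hs]]] [D [sig [hsig ht]]].
apply/eqP; rewrite -subr_eq0; apply/eqP/modulus_eq0/le_anti.
rewrite modulus_ge0 andbT leNgt; apply/negP => pos.
have pos2 : 0 < modulus (s - t) / 2 by rewrite divr_gt0.
have [N hN] := expr_lt_eps C hrho pos2.
have [M hM] := expr_lt_eps D hsig pos2.
pose n := maxn N M.
have h1 := le_lt_trans (hs n) (hN n (leq_maxl _ _)).
have h2 := le_lt_trans (ht n) (hM n (leq_maxr _ _)).
have := modulusB (s - \sum_(i < n.+1) a i) (t - \sum_(i < n.+1) a i).
rewrite opprB addrA subrK.
move: h1 h2; lra.
Qed.

Definition gsum a : R[i] := xget 0 [set s | is_sum a s].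

Lemma gsumE a s : is_sum a s -> gsum a = s.
Proof.
move=> hs; rewrite /gsum; case: xgetP => [t -> /is_sum_uniq h|/(_ s)//].
exact: h.
Qed.

Lemma gsumP a (C rho : R) : 0 <= rho < 1 ->
  (forall i, modulus (a i) <= C * rho ^+ i) ->
  forall n, modulus (gsum a - \sum_(i < n) a i) <= 2 * C / (1 - rho) * rho ^+ n.
Proof.
move=> hrho ha; have [s hs] := complex_geometric_series hrho ha.
rewrite (@gsumE _ s) //; exists (2 * C / (1 - rho) * rho), rho; split=> // n.
by rewrite -mulrA -exprS.
Qed.

Lemma gsum_le a (C rho : R) : 0 <= rho < 1 ->
  (forall i, modulus (a i) <= C * rho ^+ i) ->
  modulus (gsum a) <= 2 * C / (1 - rho).
Proof.
by move=> hrho /(gsumP hrho)/(_ 0%N); rewrite big_ord0 subr0 expr0 mulr1.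
Qed.

(** Removes the first term and rescales the rest in one step, as the recurrence of
    a quotient by X - z requires. *)
Lemma gsum_recl a a' c (C rho : R) : 0 <= rho < 1 ->
  (forall i, modulus (a' i) <= C * rho ^+ i) ->
  (forall i, a i.+1 = c * a' i) ->
  gsum a = a 0%N + c * gsum a'.
Proof.
move=> hrho ha' aa'.
apply: gsumE; exists (modulus c * (2 * C / (1 - rho))), rho; split=> // n.
rewrite big_ord_recl /=.
have -> : \sum_(i < n) a (bump 0 i) = c * \sum_(i < n) a' i.
  by rewrite mulr_sumr; apply: eq_bigr => i _; rewrite -aa'.
rewrite opprD addrACA subrr add0r -mulrBr modulusM -[leRHS]mulrA.
by apply: ler_wpM2l; rewrite ?modulus_ge0 // gsumP.
Qed.

End ComplexSeries.

(** * Division of Laurent sequences by X - z *)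

Section LaurentDivision.
Variable R : realType.
Implicit Types (b d : int -> R[i]) (om : int -> R) (z : R[i]) (k : int).

Definition dominated om (C : R) b : Prop := forall k, modulus (b k) <= C * om k.

(** The coefficient form of b = (X - z) d. *)
Definition is_quotient b z d : Prop := forall k, b k = d (k - 1) - z * d k.

(** The two expansions of b / (X - z): in powers of z/X, which reads the
    coefficients of b to the left of k, and in powers of X/z, which reads those to
    the right. *)
Definition back_sum b z k : R[i] :=
  - (z^-1 * gsum (fun i : nat => b (k - i%:Z) * z ^- i)).

Definition fwd_sum b z k : R[i] :=
  gsum (fun i : nat => b (k + 1 + i%:Z) * z ^+ i).

Lemma back_sumE b z k (C rho : R) : z != 0 -> 0 <= rho < 1 ->
  (forall i : nat, modulus (b (k - 1 - i%:Z) * z ^- i) <= C * rho ^+ i) ->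
  b k = back_sum b z (k - 1) - z * back_sum b z k.
Proof.
move=> z0 hrho hb; rewrite /back_sum.
rewrite (@gsum_recl _ (fun i : nat => b (k - i%:Z) * z ^- i) _ z^-1 _ _ hrho hb).
  rewrite subr0 expr0 invr1 mulr1 mulrN opprK mulVKf //; ring.
move=> i; rewrite exprS invfM mulrCA; congr (_ * (b _ * _)); lia.
Qed.

Lemma fwd_sumE b z k (C rho : R) : 0 <= rho < 1 ->
  (forall i : nat, modulus (b (k + 1 + i%:Z) * z ^+ i) <= C * rho ^+ i) ->
  b k = fwd_sum b z (k - 1) - z * fwd_sum b z k.
Proof.
move=> hrho hb; rewrite /fwd_sum.
rewrite (@gsum_recl _ (fun i : nat => b (k - 1 + 1 + i%:Z) * z ^+ i) _ z _ _ hrho hb).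
  by rewrite addr0 expr0 mulr1 addrK subrK.
move=> i; rewrite exprS mulrCA; congr (_ * (b _ * _)); lia.
Qed.

Lemma back_sum_le b z k (C rho : R) : 0 <= rho < 1 ->
  (forall i : nat, modulus (b (k - i%:Z) * z ^- i) <= C * rho ^+ i) ->
  modulus (back_sum b z k) <= (modulus z)^-1 * (2 * C / (1 - rho)).
Proof.
move=> hrho hb; rewrite /back_sum modulusN modulusM modulusV.
by apply: ler_wpM2l; [rewrite invr_ge0 modulus_ge0 | exact: gsum_le].
Qed.

Lemma fwd_sum_le b z k (C rho : R) : 0 <= rho < 1 ->
  (forall i : nat, modulus (b (k + 1 + i%:Z) * z ^+ i) <= C * rho ^+ i) ->
  modulus (fwd_sum b z k) <= 2 * C / (1 - rho).
Proof. by move=> hrho hb; exact: gsum_le hrho hb. Qed.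

Lemma weight_iter_pred om (q : R) k (i : nat) :
  (forall k, om (k - 1) <= q * om k) -> 0 <= q ->
  om (k - i%:Z) <= q ^+ i * om k.
Proof.
move=> omq q0; elim: i => [|i IH]; first by rewrite subr0 expr0 mul1r.
rewrite (_ : k - i.+1%:Z = k - i%:Z - 1); last by lia.
by apply: le_trans (omq _) _; rewrite exprS -mulrA; apply: ler_wpM2l.
Qed.

Lemma weight_iter_succ om (p : R) k (i : nat) :
  (forall k, om (k + 1) <= p * om k) -> 0 <= p ->
  om (k + i%:Z) <= p ^+ i * om k.
Proof.
move=> omp p0; elim: i => [|i IH]; first by rewrite addr0 expr0 mul1r.
rewrite (_ : k + i.+1%:Z = k + i%:Z + 1); last by lia.
by apply: le_trans (omp _) _; rewrite exprS -mulrA; apply: ler_wpM2l.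
Qed.

(** When om decreases by a factor at most q per step to the left and q < |z|, the
    expansion in powers of z/X is dominated by a geometric series of ratio q/|z|. *)
Lemma back_division om (q : R) z b C :
  (forall k, om (k - 1) <= q * om k) -> 0 <= q < modulus z -> 0 <= C ->
  dominated om C b ->
  is_quotient b z (back_sum b z) /\
  dominated om (2 * C / (modulus z - q)) (back_sum b z).
Proof.
move=> omq /andP[q0 qz] C0 hb.
have z0 : 0 < modulus z by exact: le_lt_trans qz.
have omi k i := weight_iter_pred k i omq q0.
have hrho : 0 <= q / modulus z < 1.
  by rewrite divr_ge0 ?(ltW z0) //= ltr_pdivrMr // mul1r.
have hsum k (i : nat) :
    modulus (b (k - i%:Z) * z ^- i) <= C * om k * (q / modulus z) ^+ i.
  rewrite modulusM modulusV modulusX expr_div_n mulrA.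
  apply: ler_wpM2r; first by rewrite invr_ge0 exprn_ge0 ?(ltW z0).
  by apply: le_trans (hb _) _; rewrite -mulrA (mulrC (om k)); apply: ler_wpM2l.
split=> k.
  by apply: back_sumE hrho (hsum (k - 1)); rewrite -modulus_gt0.
apply: le_trans (back_sum_le hrho (hsum k)) _.
rewrite le_eqVlt; apply/orP; left; apply/eqP; field.
by rewrite subr_eq0 !gt_eqF.
Qed.

Lemma fwd_division om (p : R) z b C :
  (forall k, om (k + 1) <= p * om k) -> 0 <= p -> p * modulus z < 1 -> 0 <= C ->
  dominated om C b ->
  is_quotient b z (fwd_sum b z) /\
  dominated om (2 * C * p / (1 - p * modulus z)) (fwd_sum b z).
Proof.
move=> omp p0 pz C0 hb.
have omi k (i : nat) : om (k + 1 + i%:Z) <= p ^+ i * (p * om k).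
  by apply: le_trans (weight_iter_succ _ i omp p0) _; rewrite ler_wpM2l ?exprn_ge0.
have hrho : 0 <= p * modulus z < 1 by rewrite mulr_ge0 ?modulus_ge0.
have hsum k (i : nat) :
    modulus (b (k + 1 + i%:Z) * z ^+ i) <= C * (p * om k) * (p * modulus z) ^+ i.
  rewrite modulusM modulusX exprMn mulrA.
  apply: ler_wpM2r; first by rewrite exprn_ge0 ?modulus_ge0.
  by apply: le_trans (hb _) _; rewrite -mulrA (mulrC (p * _)); apply: ler_wpM2l.
split=> k; first exact: fwd_sumE hrho (hsum k).
apply: le_trans (fwd_sum_le hrho (hsum k)) _.
by rewrite le_eqVlt; apply/orP; left; apply/eqP; ring.
Qed.

(** 1/(X - z1) - 1/(X - z2) = (z1 - z2) / ((X - z1) (X - z2)): a second zero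
    survives division by a first one, with an explicit quotient. *)
Lemma quotient_swap b z1 z2 d1 d2 : z1 != z2 ->
  is_quotient b z1 d1 -> is_quotient b z2 d2 ->
  is_quotient d1 z2 (fun k => (d1 k - d2 k) / (z1 - z2)).
Proof.
move=> z12 h1 h2 k; have := h1 k; rewrite h2 => h.
have z120 : z1 - z2 != 0 by rewrite subr_eq0.
apply: (mulIf z120); rewrite mulrBl !mulrA !divfK //.
have -> : z2 * (d1 k - d2 k) = z2 * d1 k - z2 * d2 k by ring.
have -> : d1 (k - 1) = d2 (k - 1) - z2 * d2 k + z1 * d1 k by rewrite h; ring.
ring.
Qed.

End LaurentDivision.

Section UniqueDivision.
Variable R : realType.
Implicit Types (om : int -> R) (b d : int -> R[i]) (mu : R[i]) (K C : R).

(** X - mu is invertible, with inverse of norm at most K, on the space of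
    sequences dominated by multiples of om. *)
Definition uniquely_divides om K mu : Prop :=
  (forall b C, 0 <= C -> dominated om C b ->
     exists2 d, is_quotient b mu d & dominated om (K * C) d) /\
  (forall d C, is_quotient (fun=> 0) mu d -> dominated om C d -> d =1 (fun=> 0)).

(** Uniqueness: a solution of d (k - 1) = mu d k grows like |mu|^n to the left,
    faster than q^n. The lower bound m of |mu| makes the constant uniform. *)
Lemma uniquely_divides_back om (q m : R) mu :
  (forall k, 0 <= om k) -> (forall k, om (k - 1) <= q * om k) ->
  0 <= q < m -> m <= modulus mu -> uniquely_divides om (2 / (m - q)) mu.
Proof.
move=> om0 omq /andP[q0 qm] mmu.
have qmu : 0 <= q < modulus mu by rewrite q0 (lt_le_trans qm).
have mu0 : 0 < modulus mu by case/andP: qmu; exact: le_lt_trans.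
split=> [b C C0 hb|d C hd hC k].
  have [hq hD] := back_division omq qmu C0 hb.
  exists (back_sum b mu) => // k; apply: le_trans (hD k) _.
  apply: ler_wpM2r => //; rewrite mulrAC; apply: ler_wpM2r => //.
  rewrite ler_pM2l // lef_pV2 ?posrE ?subr_gt0 ?lerD2r //.
  by case/andP: qmu.
have dE n : d (k - n%:Z) = mu ^+ n * d k.
  elim: n => [|n IH]; first by rewrite subr0 expr0 mul1r.
  have /esym/eqP := hd (k - n%:Z); rewrite subr_eq0 => /eqP.
  rewrite (_ : k - n%:Z - 1 = k - n.+1%:Z); last by lia.
  by move=> ->; rewrite IH exprS mulrA.
have omn n := weight_iter_pred k n omq q0.
have C0 : 0 <= C * om k by apply: le_trans (hC k); exact: modulus_ge0.
apply/modulus_eq0/le_anti; rewrite modulus_ge0 andbT.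
apply: (@le0_of_geometric _ (q / modulus mu) (`|C| * om k)) => [|n].
  by rewrite divr_ge0 ?(ltW mu0) //= ltr_pdivrMr // mul1r; case/andP: qmu.
rewrite expr_div_n mulrA ler_pdivlMr ?exprn_gt0 // -modulusX -modulusM mulrC -dE.
apply: le_trans (hC _) _; rewrite -mulrA (mulrC (om k)).
apply: (@le_trans _ _ (`|C| * om (k - n%:Z))).
  by apply: ler_wpM2r => //; exact: ler_norm.
by apply: ler_wpM2l.
Qed.

Lemma uniquely_divides_fwd om (p m : R) mu :
  (forall k, 0 <= om k) -> (forall k, om (k + 1) <= p * om k) ->
  0 <= p -> p * m < 1 -> modulus mu <= m ->
  uniquely_divides om (2 * p / (1 - p * m)) mu.
Proof.
move=> om0 omp p0 pm mum.
have pmu : p * modulus mu < 1 by apply: le_lt_trans pm; exact: ler_wpM2l.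
split=> [b C C0 hb|d C hd hC k].
  have [hq hD] := fwd_division omp p0 pmu C0 hb.
  exists (fwd_sum b mu) => // k; apply: le_trans (hD k) _.
  apply: ler_wpM2r => //.
  have -> : 2 * p / (1 - p * m) * C = 2 * C * p / (1 - p * m) by ring.
  rewrite ler_wpM2l ?mulr_ge0 // lef_pV2 ?posrE ?subr_gt0 //.
  by rewrite lerD2l lerN2; exact: ler_wpM2l.
have dE (n : nat) : d k = mu ^+ n * d (k + n%:Z).
  elim: n => [|n IH]; first by rewrite addr0 expr0 mul1r.
  have /esym/eqP := hd (k + n.+1%:Z); rewrite subr_eq0 => /eqP.
  rewrite (_ : k + n.+1%:Z - 1 = k + n%:Z); last by lia.
  by rewrite {1}IH => ->; rewrite exprSr mulrA.
have omn n := weight_iter_succ k n omp p0.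
apply/modulus_eq0/le_anti; rewrite modulus_ge0 andbT.
apply: (@le0_of_geometric _ (p * modulus mu) (`|C| * om k)) => [|n].
  by rewrite pmu mulr_ge0 ?modulus_ge0.
rewrite (dE n) modulusM modulusX exprMn mulrA mulrC.
apply: ler_wpM2r; first by rewrite exprn_ge0 ?modulus_ge0.
apply: le_trans (hC _) _; rewrite -mulrA (mulrC (om k)).
apply: (@le_trans _ _ (`|C| * om (k + n%:Z))).
  by apply: ler_wpM2r => //; exact: ler_norm.
by apply: ler_wpM2l.
Qed.

End UniqueDivision.

Section TwoSidedWeight.
Variable R : realType.

(** The coefficient bound of a Laurent series that converges for p <= |z| <= q. *)
Definition two_sided_weight (p q : R) (k : int) : R :=
  match k with Posz n => q^-1 ^+ n | Negz n => p ^+ n.+1 end.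

Variables (p q : R).
Hypotheses (p0 : 0 < p) (pq : p <= q).

Let q0 : 0 < q. Proof. exact: lt_le_trans pq. Qed.

Lemma two_sided_weight_gt0 k : 0 < two_sided_weight p q k.
Proof. by case: k => n /=; rewrite exprn_gt0 // invr_gt0. Qed.

Lemma two_sided_weight_pred k :
  two_sided_weight p q (k - 1) <= q * two_sided_weight p q k.
Proof.
case: k => [[|n]|n].
- by rewrite (_ : 0%:Z - 1 = Negz 0) //= expr1 expr0 mulr1.
- rewrite (_ : n.+1%:Z - 1 = n%:Z); last by lia.
  by rewrite /= exprS mulVKf // gt_eqF.
- rewrite (_ : Negz n - 1 = Negz n.+1); last by lia.
  by rewrite /= exprS; apply: ler_wpM2r => //; rewrite exprn_ge0 // ltW.
Qed.

Lemma two_sided_weight_succ k :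
  two_sided_weight p q (k + 1) <= p^-1 * two_sided_weight p q k.
Proof.
case: k => [n|[|n]].
- rewrite (_ : n%:Z + 1 = n.+1%:Z); last by lia.
  rewrite /= exprS; apply: ler_wpM2r; first by rewrite exprn_ge0 // invr_ge0 ltW.
  by rewrite lef_pV2.
- by rewrite (_ : Negz 0 + 1 = 0%:Z) //= expr1 expr0 mulVf // gt_eqF.
- rewrite (_ : Negz n.+1 + 1 = Negz n); last by lia.
  by rewrite /= [in leRHS]exprS mulKf // gt_eqF.
Qed.

Lemma two_sided_weightP n : two_sided_weight p q n%:Z = q^-1 ^+ n.
Proof. by []. Qed.

Lemma two_sided_weightN n : two_sided_weight p q (- n%:Z) = p ^+ n.
Proof. by case: n => [|n]; rewrite ?oppr0 ?expr0 // -NegzE. Qed.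

End TwoSidedWeight.

(** * Laurent series on the unit circle *)

Section RootsOfUnity.
Variable R : realType.
Implicit Types (z w : R[i]).

(** For a square root v of w, (v - 1) (v + 1) = w - 1 and
    |v - 1|^2 + |v + 1|^2 = 4; the root closer to 1 has |v + 1|^2 >= 2. *)
Lemma unit_sqrt_near1 w : modulus w = 1 ->
  exists v, [/\ modulus v = 1, v ^+ 2 = w &
    modulus (v - 1) ^+ 2 <= modulus (w - 1) ^+ 2 / 2].
Proof.
move=> w1.
have [v vw] : exists v : R[i], v ^+ 2 = w by exists (sqrtC w); exact: sqrtCK.
have v1 : modulus v = 1.
  apply/eqP; rewrite -(@eqrXn2 _ 2) ?modulus_ge0 //.
  by rewrite -modulusX vw w1 expr1n.
have parallelogram (u : R[i]) : modulus u = 1 ->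
    modulus (u - 1) ^+ 2 + modulus (u + 1) ^+ 2 = 4.
  case: u => a b /=; have s0 : 0 <= a ^+ 2 + b ^+ 2 by rewrite addr_ge0 ?sqr_ge0.
  move=> h; have : a ^+ 2 + b ^+ 2 = 1 by rewrite -(sqr_sqrtr s0) h expr1n.
  rewrite !sqr_sqrtr ?addr_ge0 ?sqr_ge0 //; nra.
have prod (u : R[i]) : u ^+ 2 = w ->
    modulus (u - 1) ^+ 2 * modulus (u + 1) ^+ 2 = modulus (w - 1) ^+ 2.
  by move=> <-; rewrite -exprMn -modulusM; congr (modulus _ ^+ 2); ring.
have pick (u : R[i]) : modulus u = 1 -> u ^+ 2 = w ->
    modulus (u - 1) ^+ 2 <= modulus (u + 1) ^+ 2 ->
  exists v, [/\ modulus v = 1, v ^+ 2 = w &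
    modulus (v - 1) ^+ 2 <= modulus (w - 1) ^+ 2 / 2].
  move=> u1 uw h; exists u; split=> //.
  have := parallelogram u u1; have := prod u uw.
  have : 0 <= modulus (u - 1) ^+ 2 by exact: sqr_ge0.
  by move: h; nra.
case: (lerP (modulus (v - 1) ^+ 2) (modulus (v + 1) ^+ 2)) => [|/ltW] h.
  exact: pick h.
apply: (pick (- v)); rewrite ?modulusN ?sqrrN //.
rewrite (_ : - v - 1 = - (v + 1)); last by ring.
by rewrite (_ : - v + 1 = - (v - 1)) ?modulusN //; ring.
Qed.

Lemma root_of_minus1_near1 (n : nat) : exists w : R[i],
  [/\ modulus w = 1, w ^+ (2 ^ n) = -1 & modulus (w - 1) ^+ 2 <= 4 * (2^-1) ^+ n].
Proof.
elim: n => [|n [w [w1 wn hw]]].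
  exists (-1); rewrite expr0 expr1 modulusN modulus1; split=> //.
  rewrite -opprD modulusN (_ : 1 + 1 = (2 : R)%:C%C); last by rewrite rmorphD.
  by rewrite modulusR ger0_norm //; lra.
have [v [v1 vw hv]] := unit_sqrt_near1 w1.
exists v; split=> //; first by rewrite expnS exprM vw.
have quarter (y : R) : 4 * y / 2 = 4 * (2^-1 * y) by field.
by apply: le_trans hv _; rewrite [2^-1 ^+ _]exprS -quarter ler_pM2r.
Qed.

(** Repeated square roots of -1 tend to 1, and their orders are powers of two. *)
Lemma primitive_root_near1 (N : nat) (e : R) : 0 < e ->
  exists M w, [/\ (N < M)%N, M.-primitive_root w, modulus w = 1 &
    modulus (w - 1) < e].
Proof.
move=> e0.
have half : 0 <= (2^-1 : R) < 1.
  apply/andP; split; lra.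
have e20 : 0 < e ^+ 2 by rewrite exprn_gt0.
have [n0 hn0] := expr_lt_eps 4 half e20.
pose n := maxn n0 N.
have [w [w1 wn hw]] := root_of_minus1_near1 n.
exists (2 ^ n.+1)%N, w; split=> //.
- apply: leq_ltn_trans (leq_maxr n0 N) _; apply: ltn_trans (ltnSn _) _.
  exact: ltn_expl.
- have wn1 : w ^+ (2 ^ n.+1) = 1 by rewrite expnSr exprM wn sqrrN expr1n.
  have [m mw mdvd] := prim_order_exists (expn_gt0 2 n.+1) wn1.
  have pr2 : prime 2 by [].
  have [i ilen mE] := elimT (dvdn_pfactor m n.+1 pr2) mdvd.
  move: ilen; rewrite leq_eqVlt => /orP[/eqP iE|]; first by rewrite -iE -mE.
  rewrite ltnS => iln; exfalso.
  have : w ^+ (2 ^ n) == 1 by rewrite -(prim_order_dvd mw) mE dvdn_exp2l.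
  by rewrite wn eqNr oner_eq0.
- rewrite -(@ltr_pXn2r _ 2) ?nnegrE ?modulus_ge0 ?(ltW e0) //.
  by apply: le_lt_trans hw _; apply: hn0; rewrite leq_maxl.
Qed.

Lemma distinct_points_near (z : R[i]) (delta : R) n : modulus z = 1 -> 0 < delta ->
  exists s : seq R[i], [/\ uniq s, size s = n &
    forall t, t \in s -> modulus t = 1 /\ modulus (t - z) < delta].
Proof.
move=> z1 delta0.
have e0 : 0 < delta / n.+1%:R by rewrite divr_gt0 // ltr0n.
have [M [w [nM hw w1 wlt]]] := primitive_root_near1 n e0.
have z0 : z != 0 by rewrite -modulus_gt0 z1.
have wj j : modulus (w ^+ j - 1) <= j%:R * modulus (w - 1).
  elim: j => [|j IH]; first by rewrite expr0 subrr modulus0 mul0r.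
  rewrite exprS (_ : w * w ^+ j - 1 = w * (w ^+ j - 1) + (w - 1)); last by ring.
  apply: le_trans (modulusD _ _) _; rewrite modulusM w1 mul1r.
  by rewrite -natr1 mulrDl mul1r lerD2r.
exists [seq z * w ^+ j | j <- iota 0 n]; split.
- rewrite map_inj_in_uniq ?iota_uniq // => i j; rewrite !mem_iota !add0n /= => hi hj.
  move/(mulfI z0)/eqP; rewrite (eq_prim_root_expr hw) => /eqP.
  by rewrite !modn_small //; exact: ltn_trans nM.
- by rewrite size_map size_iota.
- move=> t /mapP[j]; rewrite mem_iota add0n /= => jn ->.
  rewrite modulusM modulusX z1 w1 expr1n mulr1; split=> //.
  rewrite -[X in _ - X]mulr1 -mulrBr modulusM z1 mul1r.
  apply: le_lt_trans (wj j) _; rewrite mulrC.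
  rewrite ltr_pdivlMr ?ltr0n // in wlt.
  apply: le_lt_trans wlt; apply: ler_wpM2l; first exact: modulus_ge0.
  by rewrite ler_nat ltnW // ltnS ltnW.
Qed.

End RootsOfUnity.

Section UnitCircle.
Variables (R : realType) (theta : R).
Hypothesis theta01 : 0 < theta < 1.
Implicit Types (b d : int -> R[i]) (z : R[i]) (k : int).

Definition geom_weight k : R := theta ^+ `|k|%N.

Let theta0 : 0 < theta. Proof. by case/andP: theta01. Qed.
Let theta1 : theta < 1. Proof. by case/andP: theta01. Qed.
Let theta_rho : 0 <= theta < 1. Proof. by rewrite ltW //= theta1. Qed.

(** Division with remainder: b = (X - z) d + r, so that r is the value of b at z. *)
Definition is_division b z d (r : R[i]) : Prop :=
  forall k, b k = d (k - 1) - z * d k + (if k == 0 then r else 0).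

Lemma is_quotient_division b z d : is_quotient b z d <-> is_division b z d 0.
Proof. by split=> h k; have := h k; rewrite if_same addr0. Qed.

(** The bound does not depend on the point z of the circle; the whole identity
    theorem rests on this. *)
Definition division_norm : R := 2 / (1 - theta).

(** On the unit circle neither expansion of the quotient is good everywhere: the
    coefficients of negative index are summed from the left and the others from the
    right. The recurrence fails only where the two choices meet, at index 0, and
    the defect is the remainder. *)
Lemma circle_division z b (C : R) : modulus z = 1 ->
  dominated geom_weight C b ->
  exists d r, is_division b z d r /\ dominated geom_weight (division_norm * C) d.
Proof.
move=> z1 hb.
have z0 : z != 0 by rewrite -modulus_gt0 z1.
have zX n : modulus (z ^+ n) = 1 by rewrite modulusX z1 expr1n.
have zV n : modulus (z ^- n) = 1 by rewrite modulusV zX invr1.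
have hneg k : k <= 0 -> forall i : nat,
    modulus (b (k - i%:Z) * z ^- i) <= C * geom_weight k * theta ^+ i.
  move=> k0 i; rewrite modulusM zV mulr1; apply: le_trans (hb _) _.
  by rewrite /geom_weight -mulrA -exprD (_ : `|(k - i%:Z)%R|%N = (`|k| + i)%N) //; lia.
have hpos k : 0 <= k -> forall i : nat,
    modulus (b (k + 1 + i%:Z) * z ^+ i) <= C * geom_weight (k + 1) * theta ^+ i.
  move=> k0 i; rewrite modulusM zX mulr1; apply: le_trans (hb _) _.
  rewrite /geom_weight -mulrA -exprD.
  by rewrite (_ : `|(k + 1 + i%:Z)%R|%N = (`|(k + 1)%R| + i)%N) //; lia.
have C0 : 0 <= C.
  by have := hb 0; rewrite /geom_weight expr0 mulr1; apply: le_trans; exact: modulus_ge0.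
pose d k := if k < 0 then back_sum b z k else fwd_sum b z k.
exists d, (b 0 - (d (-1) - z * d 0)); split=> k.
  case: (ltgtP k 0) => k0; last first.
  - by rewrite k0 sub0r addrC subrK.
  - rewrite /d !ifF ?addr0; [|lia..].
    by apply: fwd_sumE theta_rho (hpos _ _); lia.
  - rewrite /d !ifT ?addr0; [|lia..].
    by apply: back_sumE z0 theta_rho (hneg _ _); lia.
rewrite /d; case: ltP => k0.
  apply: le_trans (back_sum_le theta_rho (hneg k _)) _; first exact: ltW.
  rewrite z1 invr1 mul1r le_eqVlt; apply/orP; left; apply/eqP.
  by rewrite /division_norm; ring.
apply: le_trans (fwd_sum_le theta_rho (hpos k _)) _ => //.
have -> : division_norm * C * geom_weight k = 2 * (C * geom_weight k) / (1 - theta).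
  by rewrite /division_norm; ring.
rewrite ler_pM2r ?invr_gt0 ?subr_gt0 // ler_pM2l // ler_wpM2l //.
by apply: ler_wiXn2l; rewrite ?ltW //; lia.
Qed.

(** Away from index 0 the moduli of the coefficients of e are constant, so decay
    forces them to be 0. *)
Lemma division0_uniq z e r (D : R) : modulus z = 1 ->
  is_division (fun=> 0) z e r -> dominated geom_weight D e -> e =1 (fun=> 0) /\ r = 0.
Proof.
move=> z1 he hD.
have hpos (k n : nat) : modulus (e k%:Z) = modulus (e (k + n)%N%:Z).
  elim: n => [|n ->]; first by rewrite addn0.
  have := he (k + n.+1)%N%:Z; rewrite ifF ?addr0; last by lia.
  rewrite (_ : (k + n.+1)%N%:Z - 1 = (k + n)%N%:Z); last by lia.
  by move/esym/eqP; rewrite subr_eq0 => /eqP ->; rewrite modulusM z1 mul1r.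
have hneg (k n : nat) : modulus (e (- k.+1%:Z)) = modulus (e (- (k.+1 + n)%N%:Z)).
  elim: n => [|n ->]; first by rewrite addn0.
  have := he (- (k.+1 + n)%N%:Z); case: eqP => [|_]; rewrite ?addr0; first by lia.
  rewrite (_ : - (k.+1 + n)%N%:Z - 1 = - (k.+1 + n.+1)%N%:Z); last by lia.
  by move/esym/eqP; rewrite subr_eq0 => /eqP ->; rewrite modulusM z1 mul1r.
have e0 k : e k = 0.
  apply/modulus_eq0/le_anti; rewrite modulus_ge0 andbT.
  case: (lerP 0 k) => k0.
    apply: (@le0_of_geometric _ theta (D * theta ^+ `|k|)) => // n.
    have -> : k = `|k|%N%:Z by lia.
    rewrite (hpos _ n); apply: le_trans (hD _) _.
    by rewrite /geom_weight /= -mulrA -exprD.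
  apply: (@le0_of_geometric _ theta (D * theta ^+ `|k|)) => // n.
  have -> : k = - (`|k|.-1.+1)%N%:Z by lia.
  rewrite (hneg _ n); apply: le_trans (hD _) _.
  rewrite /geom_weight -mulrA -exprD le_eqVlt; apply/orP; left; apply/eqP.
  by congr (_ * _ ^+ _); lia.
by split=> //; have := he 0; rewrite !e0 mulr0 subrr add0r => <-.
Qed.

Lemma division_uniq z b d1 r1 d2 r2 (D1 D2 : R) : modulus z = 1 ->
  is_division b z d1 r1 -> is_division b z d2 r2 ->
  dominated geom_weight D1 d1 -> dominated geom_weight D2 d2 ->
  d1 =1 d2 /\ r1 = r2.
Proof.
move=> z1 h1 h2 hD1 hD2.
have [|k|e0 r0] := @division0_uniq z (fun k => d1 k - d2 k) (r1 - r2) (D1 + D2) z1.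
- move=> k; have h := h1 k; rewrite h2 in h.
  transitivity (d1 (k - 1) - z * d1 k + (if k == 0 then r1 else 0) -
    (d2 (k - 1) - z * d2 k + (if k == 0 then r2 else 0))).
    by rewrite h subrr.
  by case: eqP => _; ring.
- apply: le_trans (modulusB _ _) _; rewrite mulrDl; exact: lerD.
split; last by apply/eqP; rewrite -subr_eq0 r0.
by move=> k; apply/eqP; rewrite -subr_eq0 e0.
Qed.

Local Notation K := division_norm.

(** A zero of b at z, expressed by divisibility, so that no value of the series
    needs to be defined. *)
Definition vanishes b z : Prop :=
  exists d (D : R), is_quotient b z d /\ dominated geom_weight D d.

Lemma division_norm_gt0 : 0 < division_norm.
Proof. by rewrite divr_gt0 // subr_gt0. Qed.

Lemma weight_le1 k : geom_weight k <= 1.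
Proof. by rewrite exprn_ile1 // ltW. Qed.

Lemma weight_pred k : geom_weight (k - 1) <= theta^-1 * geom_weight k.
Proof.
rewrite ler_pdivlMl // -exprS; apply: ler_wiXn2l; rewrite ?ltW //; lia.
Qed.

Lemma dominated_ge0 b (C : R) : dominated geom_weight C b -> 0 <= C.
Proof.
by move/(_ 0); rewrite /geom_weight expr0 mulr1; apply: le_trans; exact: modulus_ge0.
Qed.

Lemma vanishes_quotient b z (C : R) : modulus z = 1 -> dominated geom_weight C b ->
  vanishes b z ->
  exists2 d, is_quotient b z d & dominated geom_weight (K * C) d.
Proof.
move=> z1 hb [d [D [hd hD]]].
have [d' [r [hd' hD']]] := circle_division z1 hb.
have [dd' _] := division_uniq z1
  ((is_quotient_division b z d).1 hd) hd' hD hD'.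
by exists d => // k; rewrite dd'.
Qed.

(** From b = (X - z1) d and d = (X - z2) d2 + r:
    b = (X - z2) ((X - z1) d2 + r) + (z2 - z1) r. *)
Lemma division_quotient b z1 z2 d d2 r :
  is_quotient b z1 d -> is_division d z2 d2 r ->
  is_division b z2 (fun k => d2 (k - 1) - z1 * d2 k + (if k == 0 then r else 0))
    ((z2 - z1) * r).
Proof.
move=> hb hd k; rewrite hb !hd.
by case: (k == 0); case: (k - 1 == 0); ring.
Qed.

(** Each zero t divided out multiplies the constant C by K and the value at z by
    z - t. *)
Lemma remainder_le (s : seq R[i]) b z d r (C D kappa : R) :
  uniq s -> (forall t, t \in s -> modulus t = 1 /\ vanishes b t) ->
  modulus z = 1 -> (forall t, t \in s -> modulus (z - t) * K <= kappa) ->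
  dominated geom_weight C b -> is_division b z d r -> dominated geom_weight D d ->
  modulus r <= C * (1 + 2 * K) * kappa ^+ size s.
Proof.
move=> + + z1.
elim: s b d r C D => [|t s IH] b d r C D us hs hk hb hd hD.
  have [d' [r' [hd' hD']]] := circle_division z1 hb.
  have [dd' <-] := division_uniq z1 hd' hd hD' hD.
  have C0 := dominated_ge0 hb.
  have KC0 := dominated_ge0 hD'.
  have -> : r' = b 0 - (d' (-1) - z * d' 0).
    by have h := hd' 0; rewrite sub0r in h; rewrite h; case: eqP => // _; ring.
  have hb0 : modulus (b 0) <= C.
    by apply: le_trans (hb 0) _; rewrite ler_piMr // weight_le1.
  have hd0 k : modulus (d' k) <= K * C.
    by apply: le_trans (hD' k) _; rewrite ler_piMr // weight_le1.
  apply: le_trans (modulusB _ _) _.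
  apply: le_trans (lerD hb0 (modulusB _ _)) _.
  rewrite modulusM z1 mul1r /= expr0.
  have := hd0 0; have := hd0 (-1); lra.
have [t1 ht] := hs t (mem_head _ _).
have /= /andP[tns us'] := us.
have [d1 hd1 hD1] := vanishes_quotient t1 hb ht.
have hs1 u : u \in s -> modulus u = 1 /\ vanishes d1 u.
  move=> us1; have ut : t != u by apply: contraNneq tns => ->.
  have [u1 hu] := hs u (mem_behead (s := t :: s) us1); split=> //.
  have [d2 hd2 hD2] := vanishes_quotient u1 hb hu.
  exists (fun k => (d1 k - d2 k) / (t - u)), ((K * C + K * C) / modulus (t - u)).
  split; first exact: quotient_swap hd1 hd2.
  move=> k; rewrite modulusM modulusV mulrAC.
  apply: ler_wpM2r; first by rewrite invr_ge0 modulus_ge0.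
  by apply: le_trans (modulusB _ _) _; rewrite mulrDl; apply: lerD.
have [d2 [r2 [hd2 hD2]]] := circle_division z1 hD1.
have hr2 : modulus r2 <= K * C * (1 + 2 * K) * kappa ^+ size s.
  apply: (IH d1 d2 r2 (K * C)  (K * (K * C))) => // u us1; apply: hk.
  by rewrite inE us1 orbT.
have h := division_quotient hd1 hd2.
pose D' := K * (K * C) * theta^-1 + K * (K * C) + modulus r2.
have hD' : dominated geom_weight D'
    (fun k => d2 (k - 1) - t * d2 k + (if k == 0 then r2 else 0)).
  move=> k; rewrite /D' !mulrDl; apply: le_trans (modulusD _ _) _; apply: lerD.
    apply: le_trans (modulusB _ _) _; apply: lerD.
      apply: le_trans (hD2 _) _; rewrite -[leRHS]mulrA.
      by apply: ler_wpM2l; [exact: (dominated_ge0 hD2)|exact: weight_pred].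
    by rewrite modulusM t1 mul1r.
  case: eqP => [->|_]; first by rewrite /geom_weight expr0 mulr1.
  by rewrite modulus0 mulr_ge0 ?modulus_ge0 // exprn_ge0 // ltW.
have [_ ->] := division_uniq z1 hd h hD hD'.
rewrite modulusM /= exprS.
have hkt := hk t (mem_head _ _).
apply: le_trans (ler_wpM2l (modulus_ge0 _) hr2) _.
have -> : modulus (z - t) * (K * C * (1 + 2 * K) * kappa ^+ size s) =
  modulus (z - t) * K * (C * (1 + 2 * K) * kappa ^+ size s) by ring.
have -> : C * (1 + 2 * K) * (kappa * kappa ^+ size s) =
  kappa * (C * (1 + 2 * K) * kappa ^+ size s) by ring.
apply: ler_wpM2r => //.
have kappa0 : 0 <= kappa.
  by apply: le_trans hkt; rewrite mulr_ge0 ?modulus_ge0 // ltW // division_norm_gt0.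
have K0 := division_norm_gt0; have C0 := dominated_ge0 hb.
by rewrite mulr_ge0 ?exprn_ge0 // mulr_ge0 //; lra.
Qed.

(** Zeros fill an arc around z, so [remainder_le] applies with arbitrarily many of
    them, and the value at z' is 0. *)
Lemma vanishes_nearby b (C delta : R) z z' :
  0 < delta -> modulus z = 1 -> modulus z' = 1 -> dominated geom_weight C b ->
  (forall t, modulus t = 1 -> modulus (t - z) < delta -> vanishes b t) ->
  (modulus (z' - z) + delta) * K < 1 -> vanishes b z'.
Proof.
move=> delta0 z1 z'1 hb hz hK.
have K0 := division_norm_gt0.
have [d [r [hd hD]]] := circle_division z'1 hb.
exists d, (K * C); split=> //.
suff r0 : r = 0 by apply/is_quotient_division; rewrite -r0.
apply/modulus_eq0/le_anti; rewrite modulus_ge0 andbT.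
apply: (@le0_of_geometric _ ((modulus (z' - z) + delta) * K) (C * (1 + 2 * K))).
  by rewrite hK mulr_ge0 ?addr_ge0 ?modulus_ge0 // ltW.
move=> n; have [s [us <- hs]] := distinct_points_near n z1 delta0.
apply: remainder_le hb hd hD => // t /hs[t1 tz]; first by split=> //; exact: hz.
apply: ler_wpM2r; first exact: ltW.
rewrite (_ : z' - t = (z' - z) + (z - t)); last by ring.
apply: le_trans (modulusD _ _) _.
by rewrite lerD2l modulus_dist ltW.
Qed.

Definition locally_vanishes b z : Prop := exists2 delta : R, 0 < delta &
  forall t, modulus t = 1 -> modulus (t - z) < delta -> vanishes b t.

Lemma locally_vanishes_nearby b (C : R) z z' :
  dominated geom_weight C b -> modulus z = 1 -> modulus z' = 1 ->
  locally_vanishes b z -> modulus (z' - z) * K < 1 -> locally_vanishes b z'.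
Proof.
move=> hb z1 z'1 [delta delta0 hz] hK.
have K0 := division_norm_gt0.
pose e := K^-1 - modulus (z' - z).
have e0 : 0 < e by rewrite subr_gt0 -[ltRHS]mul1r ltr_pdivlMr.
exists (e / 2) => [|t t1 ht]; first by rewrite divr_gt0.
pose delta' := Num.min delta (e / 2).
have delta'0 : 0 < delta' by rewrite lt_min delta0 divr_gt0.
apply: (vanishes_nearby delta'0 z1 t1 hb).
- by move=> u u1 hu; apply: hz => //; apply: lt_le_trans hu _; rewrite ge_min lexx.
- rewrite -ltr_pdivlMr // mul1r.
  have : delta' <= e / 2 by rewrite ge_min lexx orbT.
  have : modulus (t - z) <= modulus (t - z') + modulus (z' - z).
    by rewrite (_ : t - z = (t - z') + (z' - z)) ?modulusD //; ring.
  by rewrite /e in ht *; lra.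
Qed.

(** The average over the M-th roots of unity z of z^(-k) times the partial sum of
    the series over [-N, N] is the coefficient of index k. Each partial sum
    telescopes to two boundary terms of the quotient, which are of size theta^N. *)
Lemma coef_le_of_vanishing b (C : R) (M N : nat) w (k : int) :
  dominated geom_weight C b -> M.-primitive_root w -> modulus w = 1 ->
  (forall j, vanishes b (w ^+ j)) ->
  (`|k| <= N)%N -> (N.*2 < M)%N ->
  modulus (b k) <= 2 * K * C * theta ^+ N.
Proof.
move=> hb hw w1 van kN NM.
have M0 : (0 < M)%N by exact: leq_ltn_trans NM.
pose i0 := `|(k + N%:Z)%R|%N.
have i0N : (i0 <= N.*2)%N by rewrite /i0; lia.
have kE : k = i0%:Z - N%:Z by rewrite /i0; lia.
have wX j : modulus (w ^+ j) = 1 by rewrite modulusX w1 expr1n.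
(* Indices are shifted by N so that only powers with natural exponents occur. *)
pose S j := \sum_(i < N.*2.+1) b (i%:Z - N%:Z) * (w ^+ j) ^+ i.
have SE j : modulus (S j) <= 2 * K * C * theta ^+ N.
  have [d hd hD] := vanishes_quotient (wX j) hb (van j).
  have -> : S j = d (- N%:Z - 1) - (w ^+ j) ^+ N.*2.+1 * d N%:Z.
    rewrite /S (eq_bigr (fun i : 'I_N.*2.+1 =>
      - ((w ^+ j) ^+ i.+1 * d (i.+1%:Z - N%:Z - 1) -
         (w ^+ j) ^+ i * d (i%:Z - N%:Z - 1)))); last first.
      move=> i _; rewrite hd (_ : i.+1%:Z - N%:Z - 1 = i%:Z - N%:Z); last by lia.
      by rewrite exprS; ring.
    rewrite sumrN -(big_mkord xpredT (fun i : nat =>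
      (w ^+ j) ^+ i.+1 * d (i.+1%:Z - N%:Z - 1) -
         (w ^+ j) ^+ i * d (i%:Z - N%:Z - 1))).
    rewrite (telescope_sumr (fun i => (w ^+ j) ^+ i * d (i%:Z - N%:Z - 1))) //.
    rewrite (_ : N.*2.+1%:Z - N%:Z - 1 = N%:Z); last by lia.
    by rewrite sub0r expr0 mul1r opprB.
  apply: le_trans (modulusB _ _) _.
  rewrite modulusM modulusX wX expr1n mul1r.
  have h1 : modulus (d N%:Z) <= K * C * theta ^+ N by exact: hD.
  have h2 : modulus (d (- N%:Z - 1)) <= K * C * theta ^+ N.
    apply: le_trans (hD _) _; apply: ler_wpM2l; first exact: dominated_ge0 hD.
    by apply: ler_wiXn2l; rewrite ?ltW //; lia.
  by lra.
(* M - i0 stands for - i0, as the M-th powers are 1. *)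
have sum_pow (i : nat) : (i <= N.*2)%N ->
    \sum_(j < M) (w ^+ j) ^+ (M - i0 + i) = if i == i0 then M%:R else 0.
  move=> iN.
  have E (j : nat) : (w ^+ j) ^+ (M - i0 + i) = (w ^+ (M - i0 + i)) ^+ j.
    by rewrite -!exprM mulnC.
  rewrite (eq_bigr (fun j : 'I_M => (w ^+ (M - i0 + i)) ^+ j)); last first.
    by move=> j _; exact: E.
  case: eqP => [->|ne].
    rewrite subnK; last by lia.
    rewrite (prim_expr_order hw) (eq_bigr (fun=> 1)).
      by rewrite sumr_const card_ord.
    by move=> j _; rewrite expr1n.
  have ne1 : w ^+ (M - i0 + i) != 1.
    rewrite -(prim_order_dvd hw); apply/negP => /dvdnP[c hc].
    have : (0 < c < 2)%N by apply/andP; split; nia.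
    by case: c hc => [|[|c]] // hc _; lia.
  apply: (mulfI (x := w ^+ (M - i0 + i) - 1)); first by rewrite subr_eq0.
  by rewrite -subrX1 mulr0 exprAC (prim_expr_order hw) expr1n subrr.
have coefE : M%:R * b k = \sum_(j < M) (w ^+ j) ^+ (M - i0) * S j.
  under eq_bigr do rewrite mulr_sumr.
  rewrite exchange_big /=.
  have i0lt : (i0 < N.*2.+1)%N by [].
  rewrite (bigD1 (Ordinal i0lt)) //= [X in _ + X]big1 ?addr0.
    rewrite kE -[X in X * _](_ : \sum_(j < M) (w ^+ j) ^+ (M - i0 + i0) = _).
      rewrite mulr_suml; apply: eq_bigr => j _.
      by rewrite mulrCA -exprD mulrC.
    by rewrite sum_pow // eqxx.
  move=> i ii0; have ne : (i : nat) != i0 by [].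
  rewrite (eq_bigr (fun j : 'I_M => b (i%:Z - N%:Z) * (w ^+ j) ^+ (M - i0 + i))).
    by rewrite -mulr_sumr sum_pow ?(negbTE ne) ?mulr0 // -ltnS.
  by move=> j _; rewrite mulrCA -exprD.
have MR : (0 : R) < M%:R by rewrite ltr0n.
rewrite -(ler_pM2l MR) -[X in X * _](_ : modulus (M%:R : R[i]) = _); last first.
  by rewrite -(rmorph_nat (real_complex R)) modulusR ger0_norm // ler0n.
rewrite -modulusM coefE; apply: le_trans (modulus_sum _ _ _) _.
have -> : M%:R * (2 * K * C * theta ^+ N) = \sum_(j < M) 2 * K * C * theta ^+ N.
  by rewrite sumr_const card_ord mulr_natl.
by apply: ler_sum => j _; rewrite modulusM modulusX wX expr1n mul1r.
Qed.

(** Vanishing spreads from 1 to all powers of a root of unity w closer to 1 than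
    1/K; its order can be taken larger than any given bound. *)
Theorem laurent_identity b (C : R) :
  dominated geom_weight C b -> locally_vanishes b 1 -> forall k, b k = 0.
Proof.
move=> hb h1 k; have K0 := division_norm_gt0.
apply/modulus_eq0/le_anti; rewrite modulus_ge0 andbT.
apply: (@le0_of_geometric _ theta (2 * K * C * theta ^+ `|k|)) => [|n].
  by rewrite theta1 ltW.
have Ki : 0 < K^-1 by rewrite invr_gt0.
have [M [w [NM hw w1 wK]]] := primitive_root_near1 (`|k| + n).*2 Ki.
have wX j : modulus (w ^+ j) = 1 by rewrite modulusX w1 expr1n.
have van j : locally_vanishes b (w ^+ j).
  elim: j => [|j IH]; first by rewrite expr0.
  apply: locally_vanishes_nearby hb _ _ IH _ => //.
  rewrite (_ : w ^+ j.+1 - w ^+ j = w ^+ j * (w - 1)); last by rewrite exprSr; ring.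
  by rewrite modulusM wX mul1r -ltr_pdivlMr // mul1r.
rewrite -mulrA -exprD; apply: coef_le_of_vanishing hb hw w1 _ _ NM; last by lia.
move=> j; have [delta delta0] := van j; apply=> //.
by rewrite subrr modulus0.
Qed.

End UnitCircle.

(** * Growth of sequences from radii of convergence *)

Section LimSupInf.
Variable R : realType.
Implicit Types (u : nat -> \bar R) (y : nat -> R) (q : R).
Local Open Scope ereal_scope.

Lemma limn_esup_lt_near u q : limn_esup u < q%:E ->
  exists N, forall n, (N <= n)%N -> u n < q%:E.
Proof.
rewrite /limn_esup limf_esupE => /ereal_inf_lt[_ [V [N _ NV] <-] Vq].
exists N => n Nn; apply: le_lt_trans Vq; apply: ereal_sup_ubound.
by exists n => //; exact: NV.
Qed.

Lemma limn_einf_gt_near u q : q%:E < limn_einf u ->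
  exists N, forall n, (N <= n)%N -> q%:E < u n.
Proof.
rewrite /limn_einf -lteN2 oppeK => /limn_esup_lt_near[N hN].
by exists N => n /hN /=; rewrite EFinN lteN2.
Qed.

Lemma limn_esup_gt_freq u q : q%:E < limn_esup u ->
  forall N, exists n, (N <= n)%N /\ q%:E < u n.
Proof.
move=> h N; apply/not_existsP => hN.
have : limn_esup u <= q%:E; last by rewrite leNgt h.
rewrite /limn_esup limf_esupE.
apply: (@le_trans _ _ (ereal_sup (u @` [set n | (N <= n)%N]))).
  by apply: ereal_inf_lbound; exists [set n | (N <= n)%N] => //; exists N.
apply: ge_ereal_sup => _ [n /= Nn <-]; rewrite leNgt; apply/negP => qu.
by apply: (hN n).
Qed.

Lemma limn_einf_lt_freq u q : limn_einf u < q%:E ->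
  forall N, exists n, (N <= n)%N /\ u n < q%:E.
Proof.
rewrite /limn_einf -lteN2 oppeK => /limn_esup_gt_freq h N.
by have [n [Nn /=]] := h N; rewrite EFinN lteN2 => ?; exists n.
Qed.

Lemma nth_rootK n (x : R) : (0 < n)%N -> (0 <= x)%R -> (nth_root n x ^+ n = x)%R.
Proof.
move=> n0 x0; rewrite /nth_root -powR_mulrn ?powR_ge0 // -powRrM mulVf ?powRr1 //.
by rewrite pnatr_eq0 -lt0n.
Qed.

Lemma nth_root_ge0 n (x : R) : (0 <= nth_root n x)%R.
Proof. exact: powR_ge0. Qed.

Lemma nth_root_lt n (x q : R) : (0 < n)%N -> (0 <= x)%R ->
  (nth_root n x < q)%R -> (x <= q ^+ n)%R.
Proof.
move=> n0 x0 h; rewrite -(nth_rootK n0 x0).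
have q0 : (0 <= q)%R by apply: le_trans (ltW h); exact: nth_root_ge0.
by apply: lerXn2r; rewrite ?nnegrE ?nth_root_ge0 // ltW.
Qed.

Lemma nth_root_gt n (x q : R) : (0 < n)%N -> (0 <= x)%R -> (0 <= q)%R ->
  (q < nth_root n x)%R -> (q ^+ n <= x)%R.
Proof.
move=> n0 x0 q0 h; rewrite -[leRHS](nth_rootK n0 x0).
by apply: lerXn2r; rewrite ?nnegrE ?nth_root_ge0 // ltW.
Qed.

(** Finitely many terms are absorbed in the constant. *)
Lemma eventually_geometric y q (N : nat) : (0 < q)%R -> (forall n, (0 <= y n)%R) ->
  (forall n, (N <= n)%N -> (y n <= q ^+ n)%R) ->
  exists C, forall n, (y n <= C * q ^+ n)%R.
Proof.
move=> q0 y0 hN; exists (1 + \sum_(i < N) y i / q ^+ i)%R => n.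
have s0 (P : pred 'I_N) : (0 <= \sum_(i < N | P i) y i / q ^+ i)%R.
  by apply: sumr_ge0 => i _; rewrite divr_ge0 // exprn_ge0 // ltW.
have [Nn|nN] := leqP N n.
  apply: le_trans (hN n Nn) _; rewrite ler_peMl ?exprn_ge0 ?(ltW q0) //.
  by rewrite lerDl.
rewrite -ler_pdivrMr ?exprn_gt0 // (bigD1 (Ordinal nN)) //= addrCA lerDl.
by rewrite addr_ge0.
Qed.

End LimSupInf.

Section Beta.
Variables (R : realType) (w : int -> R).
Hypothesis w_pos : forall n : int, 0 < w n.

Lemma beta_gt0 n : 0 < beta w n.
Proof.
by case: n => n /=; rewrite ?invr_gt0; apply: prodr_gt0 => i _; exact: w_pos.
Qed.

Lemma betaS n : beta w (n + 1) = w n * beta w n.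
Proof.
case: n => n.
  rewrite (_ : n%:Z + 1 = n.+1%:Z); last by lia.
  by rewrite /= big_nat_recr //= mulrC.
case: n => [|n].
  rewrite (_ : Negz 0 + 1 = 0%:Z); last by lia.
  rewrite /= big_nat1 big_geq // NegzE mulfV //.
  by rewrite gt_eqF.
rewrite (_ : Negz n.+1 + 1 = Negz n); last by lia.
rewrite /= [in RHS]big_nat_recr //= invfM mulrCA NegzE mulfV ?mulr1 //.
by rewrite gt_eqF.
Qed.

End Beta.

Section RadiusBounds.
Variables (R : realType) (w : int -> R) (a : int -> R[i]).
Hypothesis w_pos : forall n : int, 0 < w n.

Lemma ereal_between (X Y : \bar R) : (0 <= X)%E -> (X < Y)%E ->
  exists p : R, [/\ 0 < p, (X < p%:E)%E & (p%:E < Y)%E].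
Proof.
case: X => [x| |]; last 2 first.
- by move=> _; rewrite ltNge leey.
- by rewrite leNgt ltNy0.
rewrite lee_fin => x0; case: Y => [y| |] //.
  rewrite lte_fin => xy; exists ((x + y) / 2); rewrite !lte_fin; split; lra.
by move=> _; exists (x + 1); rewrite lte_fin ltry; split=> //; lra.
Qed.

Lemma R_minus_ge0 : (0 <= R_minus w a)%E.
Proof.
apply: limf_esup_ge0 => [[N _ /(_ N (leqnn N))]|n] //.
by rewrite lee_fin nth_root_ge0.
Qed.

Lemma r3_plus_ge0 : (0 <= r3_plus w)%E.
Proof.
apply: limf_esup_ge0 => [[N _ /(_ N (leqnn N))]|n] //.
by rewrite lee_fin nth_root_ge0.
Qed.

Lemma coef_neg_bound (p : R) : 0 < p -> (R_minus w a < p%:E)%E ->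
  exists C : R, forall n : nat,
    modulus (a (- n%:Z) / (beta w (- n%:Z))%:C%C) <= C * p ^+ n.
Proof.
move=> p0 /limn_esup_lt_near[N hN].
apply: (@eventually_geometric _ _ p N.+1) => // [n|n Nn]; first exact: modulus_ge0.
apply: nth_root_lt; [lia|exact: modulus_ge0|].
by rewrite -lte_fin; apply: hN; lia.
Qed.

(** The value +oo in the definition of [R_plus] occurs only where the coefficient
    vanishes, and there the bound is trivial. *)
Lemma coef_pos_bound (q : R) : 0 < q -> (q%:E < R_plus w a)%E ->
  exists C : R, forall n : nat,
    modulus (a n%:Z / (beta w n%:Z)%:C%C) <= C * q^-1 ^+ n.
Proof.
move=> q0 /limn_einf_gt_near[N hN].
apply: (@eventually_geometric _ _ q^-1 N.+1) => [|n|n Nn].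
- by rewrite invr_gt0.
- exact: modulus_ge0.
have := hN n (ltnW Nn); case: eqP => [-> _|/eqP an0].
  by rewrite mul0r modulus0 exprn_ge0 // invr_ge0 ltW.
have n0 : (0 < n)%N by lia.
rewrite lte_fin => /(nth_root_gt n0 (modulus_ge0 _) (ltW q0)) h.
have qn0 : 0 < q ^+ n by rewrite exprn_gt0.
rewrite -[a n / _]invrK modulusV invf_div exprVn.
by rewrite lef_pV2 ?posrE //; apply: lt_le_trans h.
Qed.

Lemma beta_pos_bound (r : R) : 0 < r -> (r3_plus w < r%:E)%E ->
  exists C : R, forall n : nat, beta w n%:Z <= C * r ^+ n.
Proof.
move=> r0 /limn_esup_lt_near[N hN].
apply: (@eventually_geometric _ _ r N.+1) => // [n|n Nn].
  by rewrite ltW // beta_gt0.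
apply: nth_root_lt; [lia|by rewrite ltW // beta_gt0|].
by rewrite -lte_fin; apply: hN; lia.
Qed.

Lemma beta_neg_bound (s : R) : 0 < s -> (s%:E < r2_minus w)%E ->
  exists C : R, forall n : nat, beta w (- n%:Z) <= C * s^-1 ^+ n.
Proof.
move=> s0 /limn_einf_gt_near[N hN].
apply: (@eventually_geometric _ _ s^-1 N.+1) => [|n|n Nn].
- by rewrite invr_gt0.
- by rewrite ltW // beta_gt0.
have n0 : (0 < n)%N by lia.
have b0 := beta_gt0 w_pos (- n%:Z).
have := hN n (ltnW Nn); rewrite lte_fin div1r.
have bi0 : 0 <= (beta w (- n%:Z))^-1 by rewrite invr_ge0 ltW.
move/(nth_root_gt n0 bi0 (ltW s0)) => h.
by rewrite exprVn -[leLHS]invrK lef_pV2 ?posrE ?invr_gt0 ?exprn_gt0.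
Qed.

Lemma beta_pos_freq (t : R) : 0 <= t -> (t%:E < r3_plus w)%E ->
  forall N, exists n, (N <= n)%N /\ t ^+ n <= beta w n%:Z.
Proof.
move=> t0 /limn_esup_gt_freq h N.
have [n [Nn]] := h N.+1; rewrite lte_fin => hn.
exists n; split; first exact: ltnW.
apply: nth_root_gt hn => //; first by lia.
by rewrite ltW // beta_gt0.
Qed.

Lemma beta_neg_freq (t : R) : (r2_minus w < t%:E)%E ->
  forall N, exists n, (N <= n)%N /\ (beta w (- n%:Z))^-1 <= t ^+ n.
Proof.
move=> /limn_einf_lt_freq h N.
have [n [Nn]] := h N.+1; rewrite lte_fin div1r => hn.
exists n; split; first exact: ltnW.
apply: nth_root_lt hn => //; first by lia.
by rewrite invr_ge0 ltW // beta_gt0.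
Qed.

End RadiusBounds.

Lemma two_sided_decay (R : realType) (u : int -> R) (C1 C2 s1 s2 : R) :
  (forall k, 0 <= u k) -> 0 <= s1 -> 0 <= s2 ->
  (forall n : nat, u n%:Z <= C1 * s1 ^+ n) ->
  (forall n : nat, u (- n%:Z) <= C2 * s2 ^+ n) ->
  forall k, u k <= (C1 + C2) * Num.max s1 s2 ^+ `|k|.
Proof.
move=> u0 s10 s20 h1 h2 k.
have C10 : 0 <= C1 by have := h1 0%N; rewrite expr0 mulr1; exact: le_trans.
have C20 : 0 <= C2 by have := h2 0%N; rewrite expr0 mulr1; exact: le_trans.
case: (lerP 0 k) => k0.
  have -> : k = `|k|%N%:Z by lia.
  apply: le_trans (h1 _) _; rewrite absz_nat.
  apply: ler_pM; rewrite ?exprn_ge0 ?lerDl //.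
  by apply: lerXn2r; rewrite ?nnegrE ?le_max ?s10 ?lexx.
have -> : k = - `|k|%N%:Z by lia.
apply: le_trans (h2 _) _; rewrite abszN absz_nat.
apply: ler_pM; rewrite ?exprn_ge0 ?lerDr //.
by apply: lerXn2r; rewrite ?nnegrE ?le_max ?s10 ?s20 ?lexx ?orbT.
Qed.

(** G 0 is G j plus a geometric sum, and G j is small for arbitrarily large j. *)
Lemma telescoped_bound (R : realType) (G X : nat -> R[i]) (C theta D s : R) :
  0 <= theta < 1 -> 0 <= s < 1 ->
  (forall j, G j = G j.+1 + X j) ->
  (forall j, modulus (X j) <= C * theta ^+ j) ->
  (forall N, exists j, (N <= j)%N /\ modulus (G j) <= D * s ^+ j) ->
  modulus (G 0%N) <= C / (1 - theta).
Proof.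
move=> /andP[th0 th1] hs hG hX hfreq.
have GE n : G 0%N = G n + \sum_(i < n) X i.
  elim: n => [|n ->]; first by rewrite big_ord0 addr0.
  by rewrite big_ord_recr /= hG; ring.
rewrite leNgt; apply/negP => lt0.
have pos : 0 < modulus (G 0%N) - C / (1 - theta) by rewrite subr_gt0.
have [N hN] := expr_lt_eps D hs pos.
have [j [Nj hj]] := hfreq N.
have := hN j Nj.
have : modulus (\sum_(i < j) X i) <= C / (1 - theta).
  apply: le_trans (modulus_sum _ _ _) _.
  apply: (@le_trans _ _ (\sum_(i < j) C * theta ^+ (0 + i))).
    by apply: ler_sum => i _; exact: hX.
  have C0 : 0 <= C.
    by have := hX 0%N; rewrite expr0 mulr1; apply: le_trans; exact: modulus_ge0.
  have := @geometric_series_tail R R^o (fun i => C * theta ^+ i) C theta 0 j th0 th1.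
  rewrite expr0 mulr1 => /(_ _) h.
  apply: le_trans (ler_norm _) (h _) => i.
  by rewrite ger0_norm // mulr_ge0 // exprn_ge0.
have := modulusD (G j) (\sum_(i < j) X i); rewrite -GE.
by move: hj; lra.
Qed.

(** * The weighted shift in coordinates *)

Section WeightedShift.
Variables (R : realType) (H : completeNormedModType R[i]).
Variable dot : {dot H for (@Num.conj R[i])}.
Hypothesis norm_dot : forall y : H, `|y| ^+ 2 = dot y y.
Variable e : int -> H.
Hypothesis e_basis : orthonormal_basis dot e.
Variable w : int -> R.
Hypothesis w_pos : forall n : int, 0 < w n.
Variable S : {linear H -> H}.
Hypothesis S_bounded : continuous S.
Hypothesis S_shift : forall n : int, S (e n) = (w n)%:C%C *: e (n + 1).

(** The norm of H takes its values in the complex numbers; this is the same number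
    in R, where order reasoning is available. *)
Definition rnorm (y : H) : R := complex.Re `|y|.

Lemma rnormE (y : H) : `|y| = (rnorm y)%:C%C.
Proof. by rewrite RRe_real // normr_real. Qed.

Lemma rnorm_ge0 (y : H) : 0 <= rnorm y.
Proof. by rewrite -ler0c -rnormE. Qed.

Lemma rnormD (x y : H) : rnorm (x + y) <= rnorm x + rnorm y.
Proof. by rewrite -lecR rmorphD /= -!rnormE ler_normD. Qed.

Lemma rnormZ (c : R[i]) (y : H) : rnorm (c *: y) = modulus c * rnorm y.
Proof. by apply: complexI; rewrite rmorphM /= -!rnormE normrZ normr_modulus. Qed.

Lemma dotDl (x y z : H) : dot (x + y) z = dot x z + dot y z.
Proof. exact: linearDl. Qed.

Lemma dotBl (x y z : H) : dot (x - y) z = dot x z - dot y z.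
Proof. exact: linearBl. Qed.

Lemma dotZl (c : R[i]) (x y : H) : dot (c *: x) y = c * dot x y.
Proof. exact: linearZl_LR. Qed.

Lemma dot0l (y : H) : dot 0 y = 0.
Proof. exact: linear0l. Qed.

Lemma dot_suml (I : Type) (s : seq I) (P : pred I) (F : I -> H) (y : H) :
  dot (\sum_(i <- s | P i) F i) y = \sum_(i <- s | P i) dot (F i) y.
Proof. by apply: (big_morph (dot ^~ y)) => [u v|]; [exact: dotDl | exact: dot0l]. Qed.

Lemma dot_e (m n : int) : dot (e m) (e n) = (m == n)%:R.
Proof. by case: e_basis => h _; exact: h. Qed.

Lemma rnorm_e n : rnorm (e n) = 1.
Proof.
apply: complexI; rewrite -rnormE; apply/eqP.
by rewrite -(@eqrXn2 _ 2) // norm_dot dot_e eqxx expr1n.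
Qed.

(** Bessel's inequality for one basis vector: subtract the projection of y. *)
Lemma coord_le (y : H) n : modulus (dot y (e n)) <= rnorm y.
Proof.
rewrite -lecR -rnormE -normr_modulus -(@ler_pXn2r _ 2) ?nnegrE ?normr_ge0 //.
set c := dot y (e n).
have orth : dot (y - c *: e n) (e n) = 0.
  by rewrite dotBl dotZl dot_e eqxx mulr1 subrr.
have : 0 <= dot (y - c *: e n) (y - c *: e n) by rewrite -norm_dot exprn_ge0.
rewrite linearBr /= linearZr_LR /= orth mulr0 subr0 dotBl dotZl -norm_dot.
have -> : dot (e n) y = Num.conj c by rewrite hermC /= expr0 mul1r.
by rewrite -normCK subr_ge0.
Qed.

(** If y is orthogonal to the span of e, every vector v of the span satisfies
    |y - v|^2 = |y|^2 + |v|^2 >= |y|^2, so density forces y = 0. *)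
Lemma coord_eq0 (y : H) : (forall n, dot y (e n) = 0) -> y = 0.
Proof.
move=> hy; apply/eqP; case: (eqVneq y 0) => // y0; exfalso.
have ny : 0 < `|y| by rewrite normr_gt0.
have [_ dns] := e_basis.
have [||v [/= hv [s [c vE]]]] := dns (ball y `|y|).
- by exists y; exact: ballxx.
- exact: ball_open.
have dyv : dot y v = 0.
  rewrite vE; have : dot (\sum_(n <- s) c n *: e n) y = 0.
    rewrite dot_suml big1 // => n _; rewrite dotZl.
    have -> : dot (e n) y = Num.conj (dot y (e n)) by rewrite hermC /= expr0 mul1r.
    by rewrite hy rmorph0 mulr0.
  by rewrite hermC /= expr0 mul1r => /eqP; rewrite conjC_eq0 => /eqP.
move: hv; rewrite -ball_normE /= => hv.
have : `|y - v| ^+ 2 < `|y| ^+ 2 by rewrite ltr_pXn2r ?nnegrE.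
rewrite !norm_dot dotBl !linearBr /= dyv.
have -> : dot v y = 0 by rewrite hermC /= dyv rmorph0 mulr0.
rewrite subr0 sub0r opprK gtrDl -norm_dot.
by rewrite le_gtF // exprn_ge0.
Qed.

Lemma coord_inj (x y : H) : (forall n, dot x (e n) = dot y (e n)) -> x = y.
Proof.
move=> h; apply/eqP; rewrite -subr_eq0; apply/eqP/coord_eq0 => n.
by rewrite dotBl h subrr.
Qed.

Lemma continuous_rnorm (T : normedModType R[i]) (f : T -> H) (t : T) :
  {for t, continuous f} -> forall eps : R, 0 < eps ->
  exists2 delta : R, 0 < delta &
    forall s, `|s - t| < delta%:C%C -> rnorm (f s - f t) < eps.
Proof.
move=> /cvgrPdist_lt + eps eps0 => /(_ eps%:C%C).
rewrite ltcR => /(_ eps0) /nbhs_ballP [d /= d0 hd].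
have dR : (complex.Re d)%:C%C = d by rewrite RRe_real // gtr0_real.
exists (complex.Re d); first by rewrite -ltcR dR.
move=> s; rewrite dR => hs; have := hd s; rewrite -ball_normE /= distrC => /(_ hs).
by rewrite distrC rnormE ltcR.
Qed.

Lemma coord_shift_span (v : H) n : linear_span e v ->
  dot (S v) (e (n + 1)) = (w n)%:C%C * dot v (e n).
Proof.
move=> [s [c ->]]; rewrite linear_sum !dot_suml mulr_sumr.
apply: eq_bigr => m _; rewrite linearZ /= S_shift !dotZl !dot_e.
rewrite (inj_eq (addIr 1)); case: eqP => [->|_]; last by rewrite !mulr0.
by rewrite !mulr1 mulrC.
Qed.

(** Both sides are continuous in y and agree on the dense span of the basis. *)
Lemma coord_shift (y : H) n : dot (S y) (e (n + 1)) = (w n)%:C%C * dot y (e n).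
Proof.
apply/eqP; rewrite -subr_eq0; apply/eqP/modulus_eq0/le_anti.
rewrite modulus_ge0 andbT; apply/ler_addgt0Pr => eps eps0; rewrite add0r.
have w1 : 0 < 1 + w n by rewrite addr_gt0.
have eps'0 : 0 < eps / (1 + w n) by rewrite divr_gt0.
have [d d0 hd] := continuous_rnorm (@S_bounded y) eps'0.
have [_ dns] := e_basis.
pose r := Num.min d (eps / (1 + w n)).
have r0 : 0 < r by rewrite lt_min d0.
have [||v [/= hv hspan]] := dns (ball y r%:C%C).
- by exists y; apply: ballxx; rewrite ltcR.
- by apply: ball_open; rewrite ltcR.
move: hv; rewrite -ball_normE /= => hv.
have hv1 : rnorm (S y - S v) < eps / (1 + w n).
  rewrite -ltcR -rnormE distrC rnormE ltcR; apply: hd.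
  by rewrite distrC; apply: lt_le_trans hv _; rewrite lecR ge_min lexx.
have hv2 : rnorm (y - v) < eps / (1 + w n).
  by rewrite -ltcR -rnormE; apply: lt_le_trans hv _; rewrite lecR ge_min lexx orbT.
have -> : dot (S y) (e (n + 1)) - (w n)%:C%C * dot y (e n) =
    dot (S y - S v) (e (n + 1)) - (w n)%:C%C * dot (y - v) (e n).
  by rewrite !dotBl (coord_shift_span n hspan); ring.
apply: le_trans (modulusB _ _) _; rewrite modulusM modulusR (gtr0_norm (w_pos n)).
have -> : eps = eps / (1 + w n) + w n * (eps / (1 + w n)).
  by field; rewrite gt_eqF.
apply: lerD; first by apply: le_trans (coord_le _ _) (ltW hv1).
apply: ler_wpM2l; first exact: ltW.
by apply: le_trans (coord_le _ _) (ltW hv2).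
Qed.

(** The coefficients of the Laurent series attached to y. *)
Definition hat (y : H) (k : int) : R[i] := dot y (e k) / (beta w k)%:C%C.

Let betaC0 k : (beta w k)%:C%C != 0 :> R[i].
Proof. by rewrite -modulus_gt0 modulusR normr_gt0 gt_eqF // beta_gt0. Qed.

Lemma hat_coord y k : dot y (e k) = hat y k * (beta w k)%:C%C.
Proof. by rewrite /hat divfK. Qed.

Lemma hat_inj x y : hat x =1 hat y -> x = y.
Proof.
by move=> h; apply: coord_inj => k; rewrite !hat_coord h.
Qed.

Lemma hat_le y k : modulus (hat y k) <= rnorm y / beta w k.
Proof.
rewrite /hat modulusM modulusV modulusR gtr0_norm ?beta_gt0 //.
by rewrite ler_pM2r ?invr_gt0 ?beta_gt0 // coord_le.
Qed.

Lemma hatB x y k : hat (x - y) k = hat x k - hat y k.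
Proof. by rewrite /hat dotBl mulrBl. Qed.

Lemma hat0 k : hat 0 k = 0.
Proof. by rewrite /hat dot0l mul0r. Qed.

Lemma hatZ c y k : hat (c *: y) k = c * hat y k.
Proof. by rewrite /hat dotZl mulrA. Qed.

Lemma hat_shift y k : hat (S y) k = hat y (k - 1).
Proof.
rewrite /hat -[k in LHS](subrK 1) coord_shift (betaS w_pos).
rewrite (rmorphM (real_complex R)) invfM.
rewrite mulrACA mulfV ?mul1r //.
by rewrite -modulus_gt0 modulusR normr_gt0 gt_eqF.
Qed.

Lemma resolvent_equation (x y : H) (mu : R[i]) :
  S y - mu *: y = x <-> is_quotient (hat x) mu (hat y).
Proof.
split=> [<- k|h]; first by rewrite hatB hatZ hat_shift.
by apply: hat_inj => k; rewrite hatB hatZ hat_shift h.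
Qed.

(** The nonnegative and the negative indices are summed separately, as series
    indexed by nat; idx is one of the two constructors of int. *)
Lemma half_synthesis (idx : nat -> int) (c : int -> R[i]) (C tau : R) :
  injective idx -> 0 <= tau < 1 ->
  (forall i : nat, modulus (c (idx i)) <= C * tau ^+ i) ->
  exists y : H, [/\ rnorm y <= C / (1 - tau),
    (forall i : nat, dot y (e (idx i)) = c (idx i)) &
    (forall k, (forall i, k != idx i) -> dot y (e k) = 0)].
Proof.
move=> idx_inj htau hc; have /andP[tau0 tau1] := htau.
pose v i := c (idx i) *: e (idx i).
have small (A E : R[i]) : 0 <= A -> 0 < E ->
    exists N, forall n, (N <= n)%N -> A * (tau%:C%C) ^+ n < E.
  move=> A0 E0.
  have AR : A = (complex.Re A)%:C%C by rewrite RRe_real // ger0_real.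
  have ER : E = (complex.Re E)%:C%C by rewrite RRe_real // gtr0_real.
  have [|N hN] := @expr_lt_eps _ tau (complex.Re A) (complex.Re E) htau.
    by rewrite -ltcR -ER.
  exists N => n /hN; rewrite [X in _ -> X * _ < _]AR [X in _ -> _ < X]ER.
  by rewrite -rmorphXn -rmorphM ltcR.
have hv i : `|v i| <= C%:C%C * tau%:C%C ^+ i.
  rewrite normrZ rnormE (rnorm_e) mulr1 normr_modulus.
  by rewrite -rmorphXn -rmorphM lecR.
have [||y hy] := @geometric_series R[i] H v C%:C%C tau%:C%C _ _ small hv.
- by rewrite lecR.
- by rewrite -(rmorph1 (real_complex R)) ltcR.
have {}hy n : rnorm (y - \sum_(i < n) v i) <= C / (1 - tau) * tau ^+ n.
  rewrite -lecR -rnormE rmorphM rmorphXn /= fmorph_div /= rmorphB rmorph1.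
  exact: hy.
have dotv n k : dot (\sum_(i < n) v i) (e k) =
    \sum_(i < n) c (idx i) * (idx i == k)%:R.
  by rewrite dot_suml; apply: eq_bigr => i _; rewrite dotZl dot_e.
have lim k a (N : nat) : (forall n, dot (\sum_(i < N + n) v i) (e k) = a) ->
    dot y (e k) = a.
  move=> ha; apply/eqP; rewrite -subr_eq0; apply/eqP/modulus_eq0/le_anti.
  rewrite modulus_ge0 andbT.
  apply: (@le0_of_geometric _ tau (C / (1 - tau) * tau ^+ N)) => // n.
  rewrite -(ha n) -dotBl -mulrA -exprD.
  by apply: le_trans (hy (N + n)%N); exact: coord_le.
exists y; split.
- by have := hy 0%N; rewrite big_ord0 subr0 expr0 mulr1.
- move=> i; apply: (lim _ _ i.+1) => n; rewrite dotv.
  have ilt : (i < i.+1 + n)%N by rewrite ltn_addr.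
  rewrite (bigD1 (Ordinal ilt)) //= eqxx mulr1 big1 ?addr0 // => j ji.
  rewrite (inj_eq idx_inj) (_ : (j == i :> nat) = false) ?mulr0 //.
  by apply/negbTE.
- move=> k hk; apply: (lim _ _ 0%N) => n; rewrite dotv big1 // => i _.
  by rewrite eq_sym (negbTE (hk i)) mulr0.
Qed.

Lemma synthesis (d : int -> R[i]) (C tau : R) : 0 <= tau < 1 ->
  (forall k, modulus (d k) * beta w k <= C * tau ^+ `|k|) ->
  exists2 y : H, hat y =1 d & rnorm y <= 2 * C / (1 - tau).
Proof.
move=> htau hd; have /andP[tau0 tau1] := htau.
pose c k := d k * (beta w k)%:C%C.
have hc k : modulus (c k) <= C * tau ^+ `|k|.
  by rewrite modulusM modulusR gtr0_norm ?beta_gt0.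
have C0 : 0 <= C.
  by have := hc 0; rewrite expr0 mulr1; apply: le_trans; exact: modulus_ge0.
have [||y1 [n1 h1 z1]] := @half_synthesis Posz c C tau _ htau.
- by move=> i j [].
- by move=> i; exact: hc.
have [||y2 [n2 h2 z2]] := @half_synthesis Negz c C tau _ htau.
- by move=> i j [].
- move=> i; apply: le_trans (hc _) _; apply: ler_wpM2l => //.
  by apply: ler_wiXn2l => //; exact: ltW.
exists (y1 + y2).
  move=> k; rewrite /hat dotDl; apply: (mulIf (betaC0 k)); rewrite divfK //.
  case: k => k; first by rewrite h1 z2 ?addr0.
  by rewrite h2 z1 ?add0r.
have -> : 2 * C / (1 - tau) = C / (1 - tau) + C / (1 - tau) by ring.
exact: le_trans (rnormD y1 y2) (lerD n1 n2).
Qed.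

(** * The closed annulus lies in the local spectrum *)

Section ResolventCoefficients.
Variables (x : H) (lam : R[i]) (C theta : R).
Hypothesis lam0 : lam != 0.
Hypothesis theta01 : 0 < theta < 1.
Hypothesis coef_decay :
  dominated (geom_weight theta) C (fun k => hat x k * lam ^ k).
Local Notation rho := (modulus lam).

Let rho0 : 0 < rho. Proof. by rewrite modulus_gt0. Qed.
Let rhoN0 : rho != 0. Proof. by rewrite gt_eqF. Qed.
Let theta0 : 0 < theta. Proof. by case/andP: theta01. Qed.
Let theta_rho : 0 <= theta < 1.
Proof. by case/andP: theta01 => /ltW -> ->. Qed.
Let C0 : 0 <= C. Proof. exact: dominated_ge0 coef_decay. Qed.

Lemma hat_decay k : modulus (hat x k) <= C * geom_weight theta k * rho ^ (- k).
Proof.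
have := coef_decay k; rewrite modulusM modulusXz.
rewrite -ler_pdivlMr ?exprz_gt0 // => h.
by rewrite -invr_expz.
Qed.

(** Multiply hat y (k + j) by nu^j to telescope the recurrence to the right; the
    terms are small at the indices where [beta] beats t^n, for |nu| < t < |lam|.
    The bound is in terms of |lam|, not of nu, so it survives a limit in nu. *)
Lemma resolvent_coef_pos (nu : R[i]) (y : H) (k : int) :
  S y - nu *: y = x -> modulus nu < rho -> (rho%:E <= r3_plus w)%E -> 0 <= k ->
  modulus (hat y k) <= C * geom_weight theta k * rho ^ (- (k + 1)) / (1 - theta).
Proof.
move=> /resolvent_equation hy nurho rho3 k0.
have nu0 := modulus_ge0 nu.
have [t /andP[nut trho]] : exists t, modulus nu < t < rho.
  by exists ((modulus nu + rho) / 2); apply/andP; split; lra.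
have t0 : 0 < t by exact: le_lt_trans nut.
have t3 : (t%:E < r3_plus w)%E by apply: lt_le_trans rho3; rewrite lte_fin.
pose G (j : nat) := hat y (k + j%:Z) * nu ^+ j.
pose X (j : nat) := hat x (k + j%:Z + 1) * nu ^+ j.
have -> : hat y k = G 0%N by rewrite /G addr0 expr0 mulr1.
apply: (@telescoped_bound _ G X _ theta (rnorm y / t ^+ `|k|) (modulus nu / t)) => //.
- by rewrite divr_ge0 ?(ltW t0) //= ltr_pdivrMr // mul1r.
- move=> j; have jE : k + j.+1%:Z = k + j%:Z + 1 by clear; lia.
  by rewrite /G /X jE (hy (k + j%:Z + 1)) addrK exprS; ring.
- move=> j; rewrite /X modulusM modulusX.
  have h1 : modulus nu ^+ j <= rho ^+ j.
    by apply: lerXn2r; rewrite ?nnegrE ?(ltW rho0) // ltW.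
  apply: le_trans (ler_pM (modulus_ge0 _) _ (hat_decay _) h1) _.
    by rewrite exprn_ge0.
  have -> : C * geom_weight theta (k + j%:Z + 1) * rho ^ (- (k + j%:Z + 1)) * rho ^+ j
      = C * geom_weight theta (k + j%:Z + 1) * rho ^ (- (k + 1)).
    rewrite -mulrA exprnP -expfzDr //; congr (_ * _ ^ _); clear; lia.
  rewrite -[leRHS]mulrAC; apply: ler_wpM2r; first by rewrite exprz_ge0 // ltW.
  rewrite -[leRHS]mulrA; apply: ler_wpM2l => //.
  rewrite /geom_weight -exprD; apply: ler_wiXn2l; last by clear -k0; lia.
    exact: ltW.
  by case/andP: theta01 => _ /ltW.
- move=> N; have [m [Nm hm]] := beta_pos_freq w_pos (ltW t0) t3 (N + `|k|)%N.
  exists (m - `|k|)%N; split; first by clear -Nm; lia.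
  rewrite /G (_ : k + (m - `|k|)%N%:Z = m%:Z); last by clear -k0 Nm; lia.
  rewrite modulusM modulusX expr_div_n.
  have tm : t ^+ m = t ^+ `|k| * t ^+ (m - `|k|).
    by rewrite -exprD subnKC //; clear -Nm; lia.
  have -> : rnorm y / t ^+ `|k| * (modulus nu ^+ (m - `|k|) / t ^+ (m - `|k|)) =
      rnorm y / t ^+ m * modulus nu ^+ (m - `|k|).
    by rewrite tm invfM; ring.
  apply: ler_wpM2r; first by rewrite exprn_ge0.
  apply: le_trans (hat_le _ _) _.
  apply: ler_wpM2l; first exact: rnorm_ge0.
  by rewrite lef_pV2 ?posrE ?exprn_gt0 // beta_gt0.
Qed.

(** The mirror image of [resolvent_coef_pos], telescoping to the left. *)
Lemma resolvent_coef_neg (nu : R[i]) (y : H) (k : int) :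
  S y - nu *: y = x -> rho < modulus nu -> (r2_minus w <= rho%:E)%E -> k <= 0 ->
  modulus (hat y k) <= C * geom_weight theta k * rho ^ (- (k + 1)) / (1 - theta).
Proof.
move=> /resolvent_equation hy nurho rho2 k0.
have [t /andP[trho tnu]] : exists t, rho < t < modulus nu.
  by exists ((modulus nu + rho) / 2); apply/andP; split; lra.
have t0 : 0 < t by exact: lt_trans trho.
have nu0 : 0 < modulus nu by exact: lt_trans tnu.
have nuN0 : nu != 0 by rewrite -modulus_gt0.
have t2 : (r2_minus w < t%:E)%E by apply: le_lt_trans rho2 _; rewrite lte_fin.
pose G (j : nat) := hat y (k - j%:Z) / nu ^+ j.
pose X (j : nat) := - (hat x (k - j%:Z) / nu ^+ j.+1).
have -> : hat y k = G 0%N by rewrite /G subr0 expr0 invr1 mulr1.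
apply: (@telescoped_bound _ G X _ theta (rnorm y * t ^+ `|k|) (t / modulus nu)) => //.
- by rewrite divr_ge0 ?(ltW t0) ?(ltW nu0) //= ltr_pdivrMr // mul1r.
- move=> j; have jE : k - j.+1%:Z = k - j%:Z - 1 by clear; lia.
  rewrite /G /X jE (hy (k - j%:Z)).
  have nuj : nu ^+ j != 0 by rewrite expf_neq0.
  by rewrite exprS; field; rewrite nuj nuN0.
- move=> j; rewrite /X modulusN modulusM modulusV modulusX.
  have h1 : (modulus nu ^+ j.+1)^-1 <= (rho ^+ j.+1)^-1.
    rewrite lef_pV2 ?posrE ?exprn_gt0 //.
    by apply: lerXn2r; rewrite ?nnegrE ?(ltW rho0) ?(ltW nu0) // ltW.
  apply: le_trans (ler_pM (modulus_ge0 _) _ (hat_decay _) h1) _.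
    by rewrite invr_ge0 exprn_ge0 // ltW.
  have -> : C * geom_weight theta (k - j%:Z) * rho ^ (- (k - j%:Z)) / rho ^+ j.+1
      = C * geom_weight theta (k - j%:Z) * rho ^ (- (k + 1)).
    rewrite -mulrA exprnP invr_expz -expfzDr //; congr (_ * _ ^ _); clear; lia.
  rewrite -[leRHS]mulrAC; apply: ler_wpM2r; first by rewrite exprz_ge0 // ltW.
  rewrite -[leRHS]mulrA; apply: ler_wpM2l => //.
  rewrite /geom_weight -exprD; apply: ler_wiXn2l; last by clear -k0; lia.
    exact: ltW.
  by case/andP: theta01 => _ /ltW.
- move=> N; have [m [Nm hm]] := beta_neg_freq w_pos t2 (N + `|k|)%N.
  exists (m - `|k|)%N; split; first by clear -Nm; lia.
  rewrite /G (_ : k - (m - `|k|)%N%:Z = - m%:Z); last by clear -k0 Nm; lia.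
  rewrite modulusM modulusV modulusX expr_div_n.
  have tm : t ^+ m = t ^+ `|k| * t ^+ (m - `|k|).
    by rewrite -exprD subnKC //; clear -Nm; lia.
  have -> : rnorm y * t ^+ `|k| * (t ^+ (m - `|k|) / modulus nu ^+ (m - `|k|)) =
      rnorm y * t ^+ m / modulus nu ^+ (m - `|k|).
    by rewrite tm; ring.
  apply: ler_wpM2r; first by rewrite invr_ge0 exprn_ge0 // ltW.
  apply: le_trans (hat_le _ _) _.
  by apply: ler_wpM2l; first exact: rnorm_ge0.
Qed.

End ResolventCoefficients.

(** For mu on the circle of lam, the bounds of [resolvent_coef_pos] and
    [resolvent_coef_neg] are carried to f mu along the radius: inside the circle
    for indices k >= 0, outside for k < 0. They make hat (f mu) a geometrically
    decaying quotient, so the rescaled series of x vanishes on an arc around 1. *)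
Lemma local_spectrum_of_decay (x : H) (lam : R[i]) (C theta : R) :
  lam != 0 -> 0 < theta < 1 ->
  dominated (geom_weight theta) C (fun k => hat x k * lam ^ k) ->
  x <> 0 -> (r2_minus w <= (modulus lam)%:E)%E ->
  ((modulus lam)%:E <= r3_plus w)%E ->
  local_spectrum S x lam.
Proof.
move=> lam0 theta01 hb x0 rho2 rho3 [U [Uopen [f fan feq]] Ulam].
apply: x0; set b := (fun k => hat x k * lam ^ k) in hb.
have rho0 : 0 < modulus lam by rewrite modulus_gt0.
suff van : locally_vanishes theta b 1.
  apply: hat_inj => k.
  have /eqP := laurent_identity theta01 hb van k.
  rewrite /b mulf_eq0 expfz_eq0 (negbTE lam0) andbF orbF => /eqP ->.
  by rewrite hat0.
have /nbhs_ballP[d /= d0 hd] : nbhs (lam : R[i]^o) U by exact: open_nbhs_nbhs.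
have dR : (complex.Re d)%:C%C = d by rewrite RRe_real // gtr0_real.
set r := complex.Re d in dR.
have r0 : 0 < r by rewrite -ltcR dR.
have inU (nu : R[i]) : modulus (nu - lam) < r -> U nu.
  by move=> h; apply: hd; rewrite -ball_normE /= -dR distrC normr_modulus ltcR.
exists (r / modulus lam) => [|t t1 ht]; first by rewrite divr_gt0.
pose mu : R[i] := t * lam.
have mu_rho : modulus mu = modulus lam by rewrite modulusM t1 mul1r.
have mulam : modulus (mu - lam) < r.
  rewrite (_ : mu - lam = (t - 1) * lam); last by rewrite /mu; ring.
  by rewrite modulusM -ltr_pdivlMr.
have fcont : {for (mu : R[i]^o), continuous f}.
  apply: differentiable_continuous; apply/derivable1_diffP.
  by apply: fan; exact: inU.
(* The sign c selects the side from which mu is approached. *)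
have approx (c B : R) k : `|c| <= 1 ->
    (forall h : R, 0 < h < 1 -> U ((1 + c * h)%:C%C * mu) ->
      modulus (hat (f ((1 + c * h)%:C%C * mu)) k) <= B) ->
    modulus (hat (f mu) k) <= B.
  move=> c1 hB; apply/ler_addgt0Pr => eps eps0.
  have bk0 := beta_gt0 w_pos k.
  have eps'0 : 0 < eps * beta w k by rewrite mulr_gt0.
  have [d' d'0 hd'] := continuous_rnorm fcont eps'0.
  pose m := Num.min (d' / modulus lam)
    (Num.min ((r - modulus (mu - lam)) / modulus lam) 1).
  have m0 : 0 < m by rewrite !lt_min !divr_gt0 ?subr_gt0 //=.
  pose h := m / 2.
  have h0 : 0 < h by rewrite divr_gt0.
  have hm : h < m by rewrite /h; lra.
  have hh : 0 < h < 1.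
    by rewrite h0 /=; apply: lt_le_trans hm _; rewrite !ge_min lexx !orbT.
  pose nu := (1 + c * h)%:C%C * mu.
  have numu : modulus (nu - mu) <= h * modulus lam.
    rewrite (_ : nu - mu = (c * h)%:C%C * mu); last first.
      by rewrite /nu rmorphD rmorph1 /=; ring.
    rewrite modulusM mu_rho modulusR normrM (gtr0_norm h0).
    by apply: ler_wpM2r; [exact: ltW | rewrite ler_piMl // ltW].
  have Unu : U nu.
    apply: inU; rewrite (_ : nu - lam = (nu - mu) + (mu - lam)); last by ring.
    apply: le_lt_trans (modulusD _ _) _; rewrite -ltrBrDr.
    apply: le_lt_trans numu _; rewrite -ltr_pdivlMr //.
    by apply: lt_le_trans hm _; rewrite !ge_min lexx ?orbT.
  have near_nu : rnorm (f nu - f mu) < eps * beta w k.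
    apply: hd'; rewrite normr_modulus ltcR.
    apply: le_lt_trans numu _; rewrite -ltr_pdivlMr //.
    by apply: lt_le_trans hm _; rewrite !ge_min lexx.
  rewrite (_ : hat (f mu) k = hat (f nu) k - hat (f nu - f mu) k); last first.
    by rewrite hatB; ring.
  apply: le_trans (modulusB _ _) _; apply: lerD; first exact: hB.
  apply: le_trans (hat_le _ _) _.
  by rewrite ler_pdivrMr // ltW.
have theta0 : 0 < theta by case/andP: theta01.
have theta1 : theta < 1 by case/andP: theta01.
pose B k := C * geom_weight theta k * modulus lam ^ (- (k + 1)) / (1 - theta).
have hfB k : modulus (hat (f mu) k) <= B k.
  case: (lerP 0 k) => k0.
    apply: (approx (-1)) => [|h /andP[h0 h1] Uh]; first by rewrite normrN1.
    apply: (resolvent_coef_pos lam0 theta01 hb (feq _ Uh)) => //.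
    rewrite modulusM mu_rho modulusR ger0_norm; last by lra.
    by rewrite gtr_pMl //; lra.
  apply: (approx 1) => [|h /andP[h0 h1] Uh]; first by rewrite normr1.
  apply: (resolvent_coef_neg lam0 theta01 hb (feq _ Uh)) => //; last exact: ltW.
  rewrite modulusM mu_rho modulusR ger0_norm; last by lra.
  by rewrite ltr_pMl //; lra.
exists (fun k => hat (f mu) k * lam ^ (k + 1)), (C / (1 - theta)); split=> k.
  have hq := (resolvent_equation _ _ _).1 (feq mu (inU _ mulam)).
  by rewrite /b hq subrK expfzDr // expr1z /mu; ring.
rewrite modulusM modulusXz -ler_pdivlMr ?exprz_gt0 //.
apply: le_trans (hfB k) _; rewrite /B -invr_expz.
by rewrite le_eqVlt; apply/orP; left; apply/eqP; ring.
Qed.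

Lemma annulus_sub_local_spectrum (x : H) (lam : R[i]) :
  x <> 0 ->
  (R_minus w (fun n => dot x (e n)) < (modulus lam)%:E)%E ->
  ((modulus lam)%:E < R_plus w (fun n => dot x (e n)))%E ->
  (r2_minus w <= (modulus lam)%:E)%E ->
  ((modulus lam)%:E <= r3_plus w)%E ->
  local_spectrum S x lam.
Proof.
move=> x0 hRm hRp rho2 rho3; set a := (fun n => dot x (e n)) in hRm hRp.
have [p [p0 hp]] := ereal_between (R_minus_ge0 w a) hRm.
rewrite lte_fin => prho.
have rho0 : 0 < modulus lam by exact: lt_trans prho.
have rhoE0 : (0 <= (modulus lam)%:E)%E by rewrite lee_fin ltW.
have [q [q0 + hq]] := ereal_between rhoE0 hRp; rewrite lte_fin => rhoq.
have [C1 hC1] := coef_pos_bound q0 hq.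
have [C2 hC2] := coef_neg_bound p0 hp.
have lam0 : lam != 0 by rewrite -modulus_gt0.
apply: (@local_spectrum_of_decay x lam (C1 + C2)
  (Num.max (modulus lam / q) (p / modulus lam))) => //.
  rewrite lt_max !divr_gt0 //= gt_max !ltr_pdivrMr // !mul1r.
  by rewrite rhoq.
apply: two_sided_decay.
- by move=> k; exact: modulus_ge0.
- by rewrite divr_ge0 // ltW.
- by rewrite divr_ge0 // ltW.
- move=> n; rewrite modulusM modulusXz -exprnP.
  have -> : C1 * (modulus lam / q) ^+ n = C1 * q^-1 ^+ n * modulus lam ^+ n.
    by rewrite exprMn; ring.
  by apply: ler_wpM2r; [rewrite exprn_ge0 // ltW|exact: hC1].
- move=> n; rewrite modulusM modulusXz -exprnN.
  have -> : C2 * (p / modulus lam) ^+ n = C2 * p ^+ n / modulus lam ^+ n.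
    by rewrite expr_div_n mulrA.
  by apply: ler_wpM2r; [rewrite invr_ge0 exprn_ge0 // ltW|exact: hC2].
Qed.

(** * Outside the annulus *)

Section LocalResolvent.
Variables (om : int -> R) (A tau : R).
Hypothesis tau01 : 0 <= tau < 1.
Hypothesis om_beta : forall k, om k * beta w k <= A * tau ^+ `|k|.

Lemma dominated_synthesis (d : int -> R[i]) (C : R) :
  0 <= C -> dominated om C d ->
  exists2 y : H, hat y =1 d & rnorm y <= 2 * A / (1 - tau) * C.
Proof.
move=> C0 hd.
have -> : 2 * A / (1 - tau) * C = 2 * (C * A) / (1 - tau) by ring.
apply: (synthesis tau01) => k.
apply: (@le_trans _ _ (C * om k * beta w k)).
  by apply: ler_wpM2r => //; rewrite ltW // beta_gt0.
by rewrite -!mulrA; apply: ler_wpM2l.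
Qed.

Lemma rnorm_dominated (y : H) (C : R) :
  0 <= C -> dominated om C (hat y) -> rnorm y <= 2 * A / (1 - tau) * C.
Proof.
move=> C0 /(dominated_synthesis C0)[y' hy' ny'].
by rewrite -(hat_inj hy').
Qed.

(** With T_mu the inverse of X - mu, the difference between f (mu + h) and
    f mu + h T_mu (f mu) + h^2 T_(mu + h) T_mu (f mu) is annihilated by
    X - (mu + h), hence is 0. So f has derivative T_mu (f mu) at mu. *)
Lemma local_resolvent_of_solver (x : H) (lam : R[i]) (delta K C : R) :
  0 < delta -> 0 <= K ->
  (forall mu, modulus (mu - lam) < delta -> uniquely_divides om K mu) ->
  0 <= C -> dominated om C (hat x) -> local_resolvent S x lam.
Proof.
move=> delta0 K0 hK C0 hx.
have KC0 : 0 <= K * C by rewrite mulr_ge0.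
have solve (mu : R[i]) : exists y, modulus (mu - lam) < delta ->
    is_quotient (hat x) mu (hat y) /\ dominated om (K * C) (hat y).
  case: (pselect (modulus (mu - lam) < delta)) => [hmu|nmu]; last by exists 0.
  have [d hq hd] := (hK mu hmu).1 _ _ C0 hx.
  have [y hy _] := dominated_synthesis KC0 hd.
  by exists y => _; split=> k; rewrite ?hq !hy.
have [f hf] := choice solve.
exists (ball (lam : R[i]^o) delta%:C%C); last first.
  by apply: ballxx; rewrite ltcR.
have inball (mu : R[i]^o) : ball (lam : R[i]^o) delta%:C%C mu -> modulus (mu - lam) < delta.
  by rewrite -ball_normE /= distrC normr_modulus ltcR.
split; first by apply: ball_open; rewrite ltcR.
exists f => mu /inball hmu; last first.
  by apply/resolvent_equation; have [] := hf mu hmu.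
have [q1 d1] := hf mu hmu.
have [d2 q2 hd2] := (hK mu hmu).1 _ _ KC0 d1.
have K2C0 : 0 <= K * (K * C) by rewrite mulr_ge0.
have K3C0 : 0 <= K * (K * (K * C)) by rewrite mulr_ge0.
have [y2 hy2 _] := dominated_synthesis K2C0 hd2.
pose L := `|2 * A / (1 - tau)| * (K * (K * (K * C))).
have L0 : 0 <= L by rewrite mulr_ge0.
have expansion (h : R[i]) : modulus (mu + h - lam) < delta ->
    rnorm (f (mu + h) - f mu - h *: y2) <= modulus h ^+ 2 * L.
  move=> hnu; have [q3 d3] := hf (mu + h) hnu.
  have [d4 q4 hd4] := (hK _ hnu).1 _ _ K2C0 hd2.
  have E : (fun k => hat (f (mu + h)) k - hat (f mu) k - h * d2 k - h ^+ 2 * d4 k)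
      =1 (fun=> 0).
    apply: ((hK _ hnu).2 _ (K * C + K * C + modulus h * (K * (K * C)) +
       modulus h ^+ 2 * (K * (K * (K * C))))) => k.
      have e1 := q1 k; rewrite (q3 k) in e1.
      have e2 := q2 k; have e4 := q4 k.
      have -> : hat (f (mu + h)) (k - 1) =
          hat (f mu) (k - 1) - mu * hat (f mu) k + (mu + h) * hat (f (mu + h)) k.
        by rewrite -e1; ring.
      have -> : d2 (k - 1) = hat (f mu) k + mu * d2 k by rewrite e2; ring.
      have -> : d4 (k - 1) = d2 k + (mu + h) * d4 k by rewrite e4; ring.
      ring.
    have b3 : modulus (h * d2 k) <= modulus h * (K * (K * C)) * om k.
      by rewrite modulusM -[leRHS]mulrA ler_wpM2l ?modulus_ge0 //; exact: hd2.
    have b4 : modulus (h ^+ 2 * d4 k) <= modulus h ^+ 2 * (K * (K * (K * C))) * om k.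
      have -> : modulus h ^+ 2 * (K * (K * (K * C))) * om k =
        modulus h ^+ 2 * (K * (K * (K * C)) * om k) by ring.
      rewrite modulusM modulusX; apply: ler_wpM2l (hd4 k).
      by rewrite exprn_ge0 ?modulus_ge0.
    rewrite !mulrDl; apply: le_trans (modulusB _ _) _; apply: lerD b4.
    apply: le_trans (modulusB _ _) _; apply: lerD b3.
    by apply: le_trans (modulusB _ _) _; exact: lerD (d3 k) (d1 k).
  have dom : dominated om (modulus h ^+ 2 * (K * (K * (K * C))))
      (hat (f (mu + h) - f mu - h *: y2)).
    move=> k; rewrite !hatB hatZ hy2.
    have -> : hat (f (mu + h)) k - hat (f mu) k - h * d2 k = h ^+ 2 * d4 k.
      by apply/eqP; rewrite -subr_eq0; apply/eqP; exact: E.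
    have -> : modulus h ^+ 2 * (K * (K * (K * C))) * om k =
      modulus h ^+ 2 * (K * (K * (K * C)) * om k) by ring.
    rewrite modulusM modulusX; apply: ler_wpM2l (hd4 k).
    by rewrite exprn_ge0 ?modulus_ge0.
  apply: le_trans (rnorm_dominated _ dom) _.
    by rewrite mulr_ge0 // exprn_ge0 ?modulus_ge0.
  rewrite /L mulrCA; apply: ler_wpM2l; first by rewrite exprn_ge0 ?modulus_ge0.
  by apply: ler_wpM2r => //; exact: ler_norm.
apply/cvg_ex; exists y2; apply/cvgrPdist_lt => eps eps0.
have epsR : (complex.Re eps)%:C%C = eps by rewrite RRe_real // gtr0_real.
set E := complex.Re eps in epsR.
have E0 : 0 < E by rewrite -ltcR epsR.
have L1 : 0 < L + 1 by lra.
pose r := Num.min (delta - modulus (mu - lam)) (E / (L + 1)).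
have r0 : 0 < r by rewrite lt_min subr_gt0 hmu divr_gt0.
rewrite /dnbhs /within /=; apply/nbhs_ballP.
exists r%:C%C => /=; first by rewrite ltcR.
move=> h /=; rewrite sub0r normrN normr_modulus ltcR => hr h0.
have hm0 : 0 < modulus h by rewrite modulus_gt0.
have hnu : modulus (mu + h - lam) < delta.
  rewrite addrAC; apply: le_lt_trans (modulusD _ _) _.
  by rewrite -ltrBrDl; apply: lt_le_trans hr _; rewrite ge_min lexx.
have := expansion h hnu.
rewrite (_ : h *: 1 + mu = mu + h); last by rewrite addrC /GRing.scale /= mulr1.
set z := f (mu + h) - f mu => hz.
have quotE (c : R[i]) (y z' : H) : c != 0 ->
    y - c^-1 *: z' = - c^-1 *: (z' - c *: y).
  by move=> c0; rewrite scalerBr !scaleNr scalerA mulVf // scale1r opprK addrC.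
rewrite (quotE h y2 z h0).
rewrite rnormE -epsR ltcR rnormZ modulusN modulusV mulrC ltr_pdivrMr //.
apply: le_lt_trans hz _; rewrite expr2 mulrAC -mulrA mulrC ltr_pM2r //.
have hE : modulus h < E / (L + 1) by apply: lt_le_trans hr _; rewrite ge_min lexx orbT.
move: hE; rewrite ltr_pdivlMr // => hE.
by nra.
Qed.

End LocalResolvent.

Hypothesis r2_le_r3 : (r2_minus w <= r3_plus w)%E.

(** Four radii R_minus < p < s < r2 and r3 < r < q < R_plus: p and q control the
    coefficients of x, s and r control [beta], and the gaps between them give the
    geometric rate tau. *)
Lemma weight_setup (x : H) (p s r q : R) :
  0 < p < s -> 0 < r < q ->
  (R_minus w (fun n => dot x (e n)) < p%:E)%E -> (s%:E < r2_minus w)%E ->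
  (r3_plus w < r%:E)%E -> (q%:E < R_plus w (fun n => dot x (e n)))%E ->
  [/\ p <= q,
    exists A tau : R, 0 <= tau < 1 /\
      forall k, two_sided_weight p q k * beta w k <= A * tau ^+ `|k| &
    exists2 C : R, 0 <= C & dominated (two_sided_weight p q) C (hat x)].
Proof.
move=> /andP[p0 ps] /andP[r0 rq] hRm h2 h3 hRp.
have q0 : 0 < q by exact: lt_trans rq.
have s0 : 0 < s by exact: lt_trans ps.
have pq : p <= q.
  have sr : (s%:E < r%:E)%E.
    by apply: lt_trans h2 _; apply: le_lt_trans r2_le_r3 h3.
  by rewrite lte_fin in sr; rewrite ltW // (lt_trans ps) // (lt_trans sr).
have wt0 := two_sided_weight_gt0 p0 pq.
split=> //.
- have [C1 hC1] := beta_pos_bound w_pos r0 h3.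
  have [C2 hC2] := beta_neg_bound w_pos s0 h2.
  exists (C1 + C2), (Num.max (r / q) (p / s)); split.
    rewrite le_max !divr_ge0 ?ltW //= gt_max !ltr_pdivrMr // !mul1r ps.
    by rewrite rq.
  apply: two_sided_decay.
  + by move=> k; rewrite mulr_ge0 // ltW // beta_gt0.
  + by rewrite divr_ge0 // ltW.
  + by rewrite divr_ge0 // ltW.
  + move=> n; rewrite two_sided_weightP exprMn mulrA mulrC.
    by apply: ler_wpM2r; rewrite ?exprn_ge0 // invr_ge0 ltW.
  + move=> n; rewrite two_sided_weightN exprMn mulrCA.
    by apply: ler_wpM2l; rewrite ?exprn_ge0 // ltW.
- have [C1 hC1] := coef_pos_bound q0 hRp.
  have [C2 hC2] := coef_neg_bound p0 hRm.
  have C10 : 0 <= C1.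
    by have := hC1 0%N; rewrite expr0 mulr1; apply: le_trans; exact: modulus_ge0.
  have C20 : 0 <= C2.
    by have := hC2 0%N; rewrite expr0 mulr1; apply: le_trans; exact: modulus_ge0.
  exists (C1 + C2); first exact: addr_ge0.
  case=> n.
    apply: le_trans (hC1 n) _; rewrite two_sided_weightP; apply: ler_wpM2r.
      by rewrite exprn_ge0 // invr_ge0 ltW.
    by rewrite lerDl.
  rewrite NegzE; apply: le_trans (hC2 n.+1) _; rewrite two_sided_weightN; apply: ler_wpM2r.
    by rewrite exprn_ge0 // ltW.
  by rewrite lerDr.
Qed.

(** The radius p (or q) is also chosen between |lam| and r2 (or r3), so that
    lam, and a disc around it, is on the good side of the weight. *)
Lemma outside_sub_local_resolvent (x : H) (lam : R[i]) :
  (R_minus w (fun n => dot x (e n)) < r2_minus w)%E ->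
  (r3_plus w < R_plus w (fun n => dot x (e n)))%E ->
  ((modulus lam)%:E < r2_minus w)%E \/ (r3_plus w < (modulus lam)%:E)%E ->
  local_resolvent S x lam.
Proof.
set a := (fun n => dot x (e n)) => hm hp hlam.
have rho0 : (0 <= (modulus lam)%:E)%E by rewrite lee_fin modulus_ge0.
have r30 := r3_plus_ge0 w.
have Rm0 := R_minus_ge0 w a.
case: hlam => hlam.
- have mx : (maxe (R_minus w a) (modulus lam)%:E < r2_minus w)%E.
    by rewrite gt_max hm.
  have mx0 : (0 <= maxe (R_minus w a) (modulus lam)%:E)%E by rewrite le_max rho0 orbT.
  have [p [p0 + h2p]] := ereal_between mx0 mx.
  rewrite gt_max lte_fin => /andP[hRp lamp].
  have pE0 : (0 <= p%:E)%E by rewrite lee_fin ltW.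
  have [s [s0 ps hs]] := ereal_between pE0 h2p; rewrite lte_fin in ps.
  have [q [q0 hq hRq]] := ereal_between r30 hp.
  have [r [r0 hr rq]] := ereal_between r30 hq; rewrite lte_fin in rq.
  have [||pq [A [tau [htau hA]]] [C C0 hx]] :=
    @weight_setup x p s r q _ _ hRp hs hr hRq; rewrite ?p0 ?r0 //.
  pose m := (modulus lam + p) / 2.
  have pm : p^-1 * m < 1 by rewrite mulrC ltr_pdivrMr // mul1r /m; lra.
  apply: (local_resolvent_of_solver htau hA
    (delta := (p - modulus lam) / 2) (K := 2 * p^-1 / (1 - p^-1 * m)) _ _ _ C0 hx).
  + by rewrite divr_gt0 // subr_gt0.
  + by rewrite divr_ge0 ?mulr_ge0 ?invr_ge0 ?subr_ge0 // ltW.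
  + move=> mu hmu; apply: uniquely_divides_fwd => //.
    * by move=> k; rewrite ltW // two_sided_weight_gt0.
    * by move=> k; exact: two_sided_weight_succ.
    * by rewrite invr_ge0 ltW.
    * have := modulusD (mu - lam) lam; rewrite subrK /m; lra.
- have mn : (r3_plus w < mine (R_plus w a) (modulus lam)%:E)%E.
    by rewrite lt_min hp.
  have [q [q0 hq]] := ereal_between r30 mn.
  rewrite lt_min lte_fin => /andP[hRq qlam].
  have [r [r0 hr rq]] := ereal_between r30 hq; rewrite lte_fin in rq.
  have [s [s0 hRs hs]] := ereal_between Rm0 hm.
  have [p [p0 hRp ps]] := ereal_between Rm0 hRs; rewrite lte_fin in ps.
  have [||pq [A [tau [htau hA]]] [C C0 hx]] :=
    @weight_setup x p s r q _ _ hRp hs hr hRq; rewrite ?p0 ?r0 //.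
  pose m := (modulus lam + q) / 2.
  have qm : q < m by rewrite /m; lra.
  apply: (local_resolvent_of_solver htau hA
    (delta := (modulus lam - q) / 2) (K := 2 / (m - q)) _ _ _ C0 hx).
  + by rewrite divr_gt0 // subr_gt0.
  + by rewrite divr_ge0 ?subr_ge0 // ltW.
  + move=> mu hmu; apply: uniquely_divides_back => //.
    * by move=> k; rewrite ltW // two_sided_weight_gt0.
    * by move=> k; exact: two_sided_weight_pred.
    * by rewrite qm ltW.
    * have := modulusB mu (mu - lam).
      rewrite opprB addrCA subrr addr0 /m; lra.
Qed.

End WeightedShift.

Theorem theorem4p7 (R : realType) (H : completeNormedModType R[i])
  (dot : {dot H for (@Num.conj R[i])})
  (norm_dot : forall y : H, `|y| ^+ 2 = dot y y)
  (e : int -> H) (e_basis : orthonormal_basis dot e)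
  (w : int -> R) (w_pos : forall n : int, 0 < w n)
  (w_bounded : exists M : R, forall n : int, w n <= M)
  (S : {linear H -> H}) (S_bounded : continuous S)
  (S_shift : forall n : int, S (e n) = (w n)%:C%C *: e (n + 1))
  (r2_le_r3 : (r2_minus w <= r3_plus w)%E)
  (x : H) (x_neq0 : x <> 0) :
  let a := fun n : int => dot x (e n) in
  let hyp_a := (R_minus w a < r2_minus w)%E /\ (r3_plus w < R_plus w a)%E in
  (hyp_a ->
    local_spectrum S x =
      [set z : R[i]^o | (r2_minus w <= (modulus z)%:E <= r3_plus w)%E]) /\
  (~ hyp_a ->
    [set z : R[i]^o | (maxe (R_minus w a) (r2_minus w) < (modulus z)%:E
                       < mine (R_plus w a) (r3_plus w))%E]
      `<=` local_spectrum S x).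
Proof.
move=> a hyp_a; split=> [[hm hp]|_ z /=]; last first.
  rewrite gt_max lt_min => /andP[/andP[h1 h2] /andP[h3 h4]].
  by apply: (annulus_sub_local_spectrum norm_dot e_basis w_pos S_bounded S_shift);
    rewrite // ltW.
apply/seteqP; split=> z /=; last first.
  move=> /andP[h1 h2].
  apply: (annulus_sub_local_spectrum norm_dot e_basis w_pos S_bounded S_shift) => //.
  - exact: lt_le_trans hm h1.
  - exact: le_lt_trans h2 hp.
have out := outside_sub_local_resolvent norm_dot e_basis w_pos S_bounded S_shift
  r2_le_r3 (x := x) (lam := z) hm hp.
move=> hz; apply/andP; split; rewrite leNgt; apply/negP => hlt; apply: hz; apply: out.
- by left.
- by right.
Qed.
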